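(* Let $A$ be a Zariski-closed $F$-subalgebra of $B$ (that is, $A=A^{\mathrm{cl}}$). Then $A$ has a Wedderburn decomposition $A=S\oplus J$ (a direct sum of vector spaces), where $J=\operatorname{Rad}(A)$ and $S\cong A/J$ is a subalgebra of $A$.
   Context: $F\subseteq K$ are fields, $F$ finite or infinite, $K$ algebraically closed; $B$ is a finite dimensional $K$-algebra, and $n=\dim_K B$. Choosing a $K$-base of $B$, identify $B$ with the affine space $K^{n}$ and give it the Zariski topology (closed sets are the common zero sets of subsets of $K[\lambda_1,\dots,\lambda_n]$; this does not depend on the base). For an $F$-subspace $V\subseteq B$, $V^{\mathrm{cl}}$ denotes the closure of $V$ in $B$, and $V$ is called Zariski-closed if $V=V^{\mathrm{cl}}$. For an $F$-subalgebra $A$ of $B$, $\operatorname{Rad}(A)$ denotes the unique largest nil (equivalently, nilpotent) ideal of $A$. *)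

(* Defs.v *)
From HB Require Import structures.
From mathcomp Require Import all_boot all_order all_algebra all_field.
From mathcomp Require Import mpoly.
From mathcomp Require Import boolp classical_sets functions.

Set Implicit Arguments.
Unset Strict Implicit.
Unset Printing Implicit Defensive.

Import GRing.Theory.
Local Open Scope ring_scope.
Local Open Scope classical_set_scope.

Section Zariski.
Variables (K : fieldType) (B : falgType K) (n : nat) (e : n.-tuple B).

Definition zeros (P : set {mpoly K[n]}) : set B :=
  [set v | forall p, P p -> p.@[fun i => coord e i v] = 0].

Definition zariski_closed (Z : set B) : Prop := exists P, Z = zeros P.

Definition zariski_closure (V : set B) : set B := smallest zariski_closed V.

End Zariski.

(* The inclusion of the fields F and K is a ring morphism phi : F -> K, and
   a : F acts on B as the scalar phi a. *)
Section Subalgebras.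
Variables (F K : fieldType) (phi : {rmorphism F -> K}) (B : falgType K).
Implicit Types (A I J S V X Y : set B).

Definition subspace V : Prop :=
  [/\ V 0, forall x y, V x -> V y -> V (x + y)
    & forall a x, V x -> V (phi a *: x)].

(* Subalgebras are not required to contain 1. *)
Definition subalgebra A : Prop :=
  subspace A /\ forall x y, A x -> A y -> A (x * y).

Definition ideal A I : Prop :=
  [/\ subspace I, I `<=` A
    & forall a x, A a -> I x -> I (a * x) /\ I (x * a)].

Definition nil_ideal A I : Prop :=
  ideal A I /\ forall x, I x -> exists m : nat, x ^+ m = 0.

(* The union of all nil ideals is itself a nil ideal: see Rad_largest. *)
Definition Rad A : set B := \bigcup_(I in nil_ideal A) I.

Definition direct_sum A S J : Prop :=
  [set s + j | s in S & j in J] = A /\ S `&` J = [set 0].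

(* The elements of A / J are the cosets x + J with x in A; the operations on
   cosets are given by their representatives: see coset_addE, coset_mulE and
   coset_scaleE. *)
Definition coset J (x : B) : set B := [set x + j | j in J].

Definition quotient A J : set (set B) := coset J @` A.

Definition coset_add J X Y : set B :=
  \bigcup_(x in X) \bigcup_(y in Y) coset J (x + y).

Definition coset_mul J X Y : set B :=
  \bigcup_(x in X) \bigcup_(y in Y) coset J (x * y).

Definition coset_scale J (a : F) X : set B :=
  \bigcup_(x in X) coset J (phi a *: x).

Definition isomorphic_to_quotient S A J : Prop :=
  exists h : B -> set B,
    [/\ set_bij S (quotient A J) h,
        forall x y, S x -> S y -> h (x + y) = coset_add J (h x) (h y),
        forall x y, S x -> S y -> h (x * y) = coset_mul J (h x) (h y)
      & forall a x, S x -> h (phi a *: x) = coset_scale J a (h x)].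

Lemma subspaceN V x : subspace V -> V x -> V (- x).
Proof. by case=> _ _ VZ /(VZ (-1)); rewrite rmorphN1 scaleN1r. Qed.

Lemma Rad_largest A : subalgebra A ->
  nil_ideal A (Rad A) /\ forall I, nil_ideal A I -> I `<=` Rad A.
Proof.
move=> [[A0 AD AZ] AM].
have nil0 : nil_ideal A [set 0].
  split; last by move=> x ->; exists 1%N; rewrite expr1.
  split; first split=> //.
  - by move=> x y -> ->; rewrite /= addr0.
  - by move=> a x ->; rewrite /= scaler0.
  - by move=> x ->.
  - by move=> a x _ ->; rewrite /= mulr0 mul0r.
have nilD I J : nil_ideal A I -> nil_ideal A J ->
    nil_ideal A [set x + y | x in I & y in J].
  move=> [[Isub IA IM] Inil] [[Jsub JA JM] Jnil].
  have [I0 ID IZ] := Isub; have [J0 JD JZ] := Jsub.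
  split; first split; first split.
  - by exists 0 => //; exists 0 => //; rewrite addr0.
  - move=> _ _ [x Ix [y Jy <-]] [x' Ix' [y' Jy' <-]].
    exists (x + x'); first exact: ID.
    by exists (y + y'); [exact: JD | rewrite addrACA].
  - move=> a _ [x Ix [y Jy <-]]; exists (phi a *: x); first exact: IZ.
    by exists (phi a *: y); [exact: JZ | rewrite scalerDr].
  - by move=> _ [x Ix [y Jy <-]]; apply: AD; [exact: IA | exact: JA].
  - move=> a _ Aa [x Ix [y Jy <-]].
    have [aI Ia] := IM _ _ Aa Ix; have [aJ Ja] := JM _ _ Aa Jy.
    split; [exists (a * x) => //; exists (a * y) => //; exact/esym/mulrDr|].
    by exists (x * a) => //; exists (y * a) => //; exact/esym/mulrDl.
  move=> _ [x Ix [y Jy <-]].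
  have expI m : exists2 i, I i & (x + y) ^+ m.+1 = i + y ^+ m.+1 /\
      J (y ^+ m.+1).
    elim: m => [|m [i Ii [Em Jm]]]; first by exists x; rewrite ?expr1.
    have [xi _] := IM _ _ (IA _ Ii) Ix.
    have [yi iy] := IM _ _ (JA _ Jy) Ii.
    have [yx xy] := IM _ _ (JA _ Jm) Ix.
    exists (i * (x + y) + y ^+ m.+1 * x).
      rewrite mulrDr; apply: (ID _ _ _ yx); exact: (ID _ _ xi iy).
    rewrite exprSr Em mulrDl (mulrDr (y ^+ m.+1)) addrA -exprSr; split=> //.
    by rewrite exprSr; have [] := JM _ _ (JA _ Jm) Jy.
  have [m ym0] := Jnil _ Jy; have [i Ii [Ei _]] := expI m.
  have [k ik0] := Inil _ Ii; exists (m.+1 * k)%N.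
  by rewrite exprM Ei exprSr ym0 mul0r addr0.
split; last by move=> I nI x Ix; exists I.
split; last by move=> x [I [_ nI] /nI].
split; first split.
- by exists [set 0].
- move=> x y [I nI Ix] [J nJ Jy].
  exists [set u + v | u in I & v in J]; first exact: nilD.
  by exists x => //; exists y.
- by move=> a x [I nI Ix]; exists I => //; have [[[_ _ IZ] _ _] _] := nI;
    exact: IZ.
- by move=> x [I [[_ IA _] _] /IA].
- move=> a x Aa [I nI Ix]; have [[_ _ IM] _] := nI.
  by have [ax xa] := IM _ _ Aa Ix; split; exists I.
Qed.

Lemma coset_eq J x y : subspace J -> coset J x y -> coset J y = coset J x.
Proof.
move=> Jsub [j Jj <-]; have [J0 JD JZ] := Jsub.
apply/seteqP; split=> _ [k Jk <-].
  by exists (j + k); [exact: JD | rewrite addrA].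
exists (k - j); first by apply: JD => //; exact: subspaceN.
by rewrite -addrA [k - j]addrC addNKr.
Qed.

Lemma coset_refl J x : subspace J -> coset J x x.
Proof. by case=> J0 _ _; exists 0 => //; rewrite addr0. Qed.

Lemma coset_addE J x y : subspace J ->
  coset_add J (coset J x) (coset J y) = coset J (x + y).
Proof.
move=> Jsub; have [J0 JD JZ] := Jsub; apply/seteqP; split=> z.
  case=> _ [j Jj <-] [_ [k Jk <-]]; rewrite (coset_eq (x := x + y)) //.
  by exists (j + k); [exact: JD | rewrite addrACA].
by move=> zxy; exists x; [|exists y => //]; exact: coset_refl.
Qed.

Lemma coset_mulE A J x y : ideal A J -> A x -> A y ->
  coset_mul J (coset J x) (coset J y) = coset J (x * y).
Proof.
move=> [Jsub JA JM] Ax Ay; have [J0 JD JZ] := Jsub.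
apply/seteqP; split=> z.
  case=> _ [j Jj <-] [_ [k Jk <-]]; rewrite (coset_eq (x := x * y)) //.
  exists (x * k + j * (y + k)); last by rewrite mulrDl (mulrDr x) addrA.
  rewrite mulrDr; apply: (JD _ _); first by have [] := JM _ _ Ax Jk.
  apply: JD; first by have [] := JM _ _ Ay Jj.
  by have [] := JM _ _ (JA _ Jj) Jk.
by move=> zxy; exists x; [|exists y => //]; exact: coset_refl.
Qed.

Lemma coset_scaleE J a x : subspace J ->
  coset_scale J a (coset J x) = coset J (phi a *: x).
Proof.
move=> Jsub; have [J0 JD JZ] := Jsub; apply/seteqP; split=> z.
  case=> _ [j Jj <-]; rewrite (coset_eq (x := phi a *: x)) //.
  by exists (phi a *: j); [exact: JZ | rewrite scalerDr].
by move=> zx; exists x => //; exact: coset_refl.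
Qed.

End Subalgebras.

(* Main.v *)
Require Import Defs.
From HB Require Import structures.
From mathcomp Require Import all_boot all_order all_algebra all_field.
From mathcomp Require Import mpoly.
From mathcomp Require Import boolp classical_sets functions.
From mathcomp Require Import cardinality.
From mathcomp Require Import ring zify.

Set Implicit Arguments.
Unset Strict Implicit.
Unset Printing Implicit Defensive.

Import GRing.Theory.
Local Open Scope ring_scope.
Local Open Scope classical_set_scope.

(** The proof reduces to local algebras, in which a complement of the nilpotent
    elements can be exhibited, and transports it by matrix units.

    What closedness of [A] gives, whatever the field [F], is inverses: if all
    iterates [T^k w], [k >= 0], of a point under a linear bijection [T] of [B]
    are in [A], so is [T^-1 w], because the polynomials of bounded degree form
    a finite-dimensional space on which [T] acts bijectively
    ([zclosed_backward]).  Applied to multiplication by [x] on its Fitting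
    component, this puts into [A] the Fitting idempotent of each [x] in [A],
    together with the inverse of [x] on it ([zclosed_idempotent]).  Hence, for
    a family of orthogonal idempotents [f i] of [A] of maximal size, each
    element of [f i * A * f i] is nilpotent or invertible, and the part of [A]
    orthogonal to all [f i] is nil.

    Such a local corner [E] with unit [e] is [D + N], with [N] its nilpotent
    elements and [D] a subfield ([local_splitting]).  In characteristic [0],
    [E] is a [K]-space, for a polynomial that vanishes at all multiples [n *: v]
    of [v] by natural numbers vanishes on the line of [v]; then [D = K *: e].
    In characteristic [p], [D] is a maximal torus: the elements of [E] which are
    combinations of orthogonal idempotents of [B], in number as large as
    possible.  A torus is a field embedded in a power [K^m] as a closed set.
    If it is infinite, it is parametrized by [t |-> (t ^ (p ^ a_i))_i]
    ([frobenius_curve]); if it is finite, its nonzero elements are the powers of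
    one of them.  In both cases it contains an element [w] of finite order prime
    to [p] whose centralizer in [E] is that of the torus, and [E] is the sum of
    its parts [{y | w ^ c * y = y * w}].  The part [c = 1] lies in [D + N],
    because the [p ^ u]-th power of an element is diagonalizable for large [u],
    thus in the torus by maximality when the element commutes with it, and the
    torus is perfect ([gen_comm]).  The other parts are nil: for an infinite
    torus they shift the weights [a_i] in one direction
    ([infinite_torus_complement]); for a finite one, an invertible element in
    such a part would make [E / N] contain a cyclic crossed product over a
    finite field, which has zero divisors because the norm of finite fields is
    surjective ([finite_torus_complement]).

    Finally, group the [f i] by the existence of [u] in [f i * A * f j] and [v]
    in [f j * A * f i] with [u * v = f i] and [v * u = f j].  The complement [S]
    consists of the matrices, with respect to these matrix units, with entries
    in the fields [D].  All the other Peirce components lie in the radical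
    ([nil_peirce_Rad]), since an ideal with nil diagonal Peirce components is
    quasi-regular, hence nil by the existence of idempotents
    ([peirce_nil_ideal]). *)

(** * Polynomials on a finite-dimensional algebra *)

Section PolynomialSubstitution.
Variables (K : fieldType) (n : nat).

Lemma msizeM_leS k (p q : {mpoly K[k]}) a b :
  (msize p <= a.+1)%N -> (msize q <= b.+1)%N -> (msize (p * q) <= (a + b).+1)%N.
Proof.
have [->|p0] := eqVneq p 0; first by rewrite mul0r msize0.
have [->|q0] := eqVneq q 0; first by rewrite mulr0 msize0.
rewrite msizeM //; move: (msize p) (msize q) => u v; lia.
Qed.

Lemma msizeX_leS k (p : {mpoly K[k]}) d :
  (msize p <= 2)%N -> (msize (p ^+ d) <= d.+1)%N.
Proof.
move=> p2; elim: d => [|d IH]; first by rewrite expr0 msize1.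
by rewrite exprS; apply: (@msizeM_leS _ _ _ 1 d).
Qed.

Lemma msize_comp_affine k (p : {mpoly K[n]}) (lq : n.-tuple {mpoly K[k]}) :
  (forall i, msize (tnth lq i) <= 2)%N -> (msize (p \mPo lq) <= msize p)%N.
Proof.
move=> lq2; rewrite comp_mpolyEX.
apply: leq_trans (msize_sum _ _ _) _.
apply/bigmax_leqP_seq => m mp _.
apply: leq_trans (msizeZ_le _ _) _.
apply: leq_trans (msize_mdeg_lt mp); rewrite comp_mpolyX mdegE.
elim/big_rec2: _ => [|i a q _ IH]; first by rewrite msize1.
by apply: msizeM_leS => //; apply: msizeX_leS.
Qed.

(** Polynomials of bounded degree form a finite-dimensional space. *)
Lemma bounded_msize_dependent d (q : nat -> {mpoly K[n]}) :
  (forall k, msize (q k) <= d)%N ->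
  exists N (c : 'I_N -> K),
    (exists i, c i != 0) /\ \sum_(i < N) c i *: q i = 0.
Proof.
move=> qd; pose D := #|{: 'X_{1..n < d}}|.
pose M := \matrix_(i < D.+1, j < D) (q i)@_(enum_val j : 'X_{1..n < d}).
have : kermx M != 0.
  apply/eqP=> k0; have := mxrank_ker M; rewrite k0 mxrank0.
  by have := rank_leq_col M; lia.
case/rowV0Pn=> v /sub_kermxP vM /rV0Pn [i vi].
exists D.+1, (v 0); split; first by exists i.
apply/mpolyP=> m; rewrite mcoeff0 raddf_sum /=.
have [md|md] := ltnP (mdeg m) d; last first.
  apply: big1 => j _; rewrite mcoeffZ; apply/eqP; rewrite mulf_eq0 mcoeff_eq0.
  by rewrite msize_mdeg_ge ?orbT //; apply: leq_trans md.
have /matrixP/(_ 0 (enum_rank (BMultinom md))) := vM.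
rewrite mxE [RHS]mxE => vM0; rewrite -[RHS]vM0; apply: eq_bigr => j _.
by rewrite mcoeffZ mxE enum_rankK.
Qed.

End PolynomialSubstitution.

Section ZariskiClosed.
Variables (K : fieldType) (B : falgType K) (n : nat) (b : n.-tuple B).
Hypothesis hb : basis_of fullv b.

Notation "p .@@ v" := (p.@[fun i => coord b i v]) (at level 2, format "p .@@ v").

Definition vanishing (A : set B) (p : {mpoly K[n]}) : Prop :=
  forall a, A a -> p.@@a = 0.

Definition zclosed (A : set B) : Prop :=
  forall v, (forall p, vanishing A p -> p.@@v = 0) -> A v.

Lemma closure_zclosed A : A = zariski_closure b A -> zclosed A.
Proof.
move=> AE v hv; rewrite AE => Z [[P ->] AP] p Pp.
by apply: hv => a Aa; apply: AP Aa _ Pp.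
Qed.

Lemma coord_sumE (v : B) : v = \sum_i coord b i v *: b`_i.
Proof. by apply: coord_basis hb _; rewrite memvf. Qed.

(** Substituting these polynomials pulls a polynomial function on [B] back
    along the linear map [x |-> \sum_j x j *: f j]. *)
Definition linear_mpolys k (f : 'I_k -> B) : n.-tuple {mpoly K[k]} :=
  [tuple \sum_j coord b i (f j) *: 'X_j | i < n].

Lemma linear_mpolys_eval k (f : 'I_k -> B) (p : {mpoly K[n]}) x :
  (p \mPo linear_mpolys f).@[x] = p.@@(\sum_j x j *: f j).
Proof.
rewrite comp_mpoly_meval; apply: meval_eq => i.
rewrite tnth_mktuple raddf_sum linear_sum; apply: eq_bigr => j _ /=.
by rewrite mevalZ mevalXU linearZ /= mulrC.
Qed.

Lemma linear_mpolys_msize k (f : 'I_k -> B) i :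
  (msize (tnth (linear_mpolys f) i) <= 2)%N.
Proof.
rewrite tnth_mktuple; apply: leq_trans (msize_sum _ _ _) _.
apply/bigmax_leqP_seq => j _ _; apply: leq_trans (msizeZ_le _ _) _.
by rewrite msizeX mdeg1.
Qed.

(** For [p] vanishing on [A], the polynomials [q k = p \o T^k] are linearly
    dependent.  Evaluating a dependency whose first nonzero term has index [i]
    at the preimage of [w] of order [i + 1], all terms but this one are values
    of [p] at points [T^k w] of [A], so [p] vanishes at the preimage of [w]. *)
Lemma zclosed_backward A (T : {linear B -> B}) (T' : B -> B) w :
  zclosed A -> cancel T' T -> (forall k, A (iter k T w)) -> A (T' w).
Proof.
move=> clA TK Aw; apply: clA => p pA.
pose q k := p \mPo linear_mpolys (fun j : 'I_n => iter k T b`_j).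
have qE k v : (q k).@@v = p.@@(iter k T v).
  rewrite linear_mpolys_eval.
  suff -> : iter k T v = \sum_j coord b j v *: iter k T b`_j by [].
  elim: k => [|k IH] /=; first exact: coord_sumE.
  by rewrite IH linear_sum; apply: eq_bigr => j _; rewrite linearZ.
have [|N [c [[i0 ci0] cq]]] := @bounded_msize_dependent K n (msize p) q.
  by move=> k; apply: msize_comp_affine; apply: linear_mpolys_msize.
have [i ci imin] := arg_minnP (P := fun i => c i != 0) (fun i : 'I_N => nat_of_ord i) ci0.
have iterK k v : iter k T (iter k T' v) = v.
  by elim: k v => // k IH v; rewrite iterSr /= TK IH.
have := congr1 (fun r => r.@@(iter i.+1 T' w)) cq.
rewrite meval0 raddf_sum /= (bigD1 i) //= big1 ?addr0 => [|j ji].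
  rewrite mevalZ qE -iterS iterSr iterK => /eqP.
  by rewrite mulf_eq0 (negPf ci) => /eqP.
rewrite mevalZ; have [->|cj] := eqVneq (c j) 0; first by rewrite mul0r.
have ij : (i < j)%N.
  by have := imin _ cj; rewrite leq_eqVlt eq_sym (negPf ji : (j == i :> nat) = _).
rewrite qE -iterS -(subnK ij) iterD iterK pA ?mulr0 //; exact: Aw.
Qed.

End ZariskiClosed.

(** * Nilpotent elements and local corners *)

Section Nilpotents.
Variable R : nzRingType.
Implicit Types (x y g : R) (E : set R).

Definition nilpot x := exists k : nat, x ^+ k = 0.

Lemma nilpot0 : nilpot 0. Proof. by exists 1%N; rewrite expr1. Qed.

Lemma nilpotN x : nilpot x -> nilpot (- x).
Proof. by case=> k xk; exists k; rewrite exprNn xk mulr0. Qed.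

Lemma exprM_shift x y k : (y * x) ^+ k.+1 = y * (x * y) ^+ k * x.
Proof.
elim: k => [|k IH]; first by rewrite expr1 expr0 mulr1.
by rewrite exprS IH [in RHS]exprS !mulrA.
Qed.

Lemma nilpot_mulC x y : nilpot (x * y) -> nilpot (y * x).
Proof. by case=> k xy0; exists k.+1; rewrite exprM_shift xy0 mulr0 mul0r. Qed.

Lemma nilpot_idem g : g * g = g -> nilpot g -> g = 0.
Proof.
move=> gg [[|k]]; first by rewrite expr0 => /eqP; rewrite oner_eq0.
suff -> : g ^+ k.+1 = g by [].
by elim: k => [|k IH]; rewrite ?expr1 // exprS IH.
Qed.

Lemma nilpot_geometric x k :
  x ^+ k = 0 -> (1 - x) * (\sum_(i < k) x ^+ i) = 1
             /\ (\sum_(i < k) x ^+ i) * (1 - x) = 1.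
Proof.
move=> xk; have E : (1 - x) * (\sum_(i < k) x ^+ i) = 1.
  by have := subrX1 x k; rewrite xk sub0r -[1 - x]opprB mulNr => <-; rewrite opprK.
split=> //; rewrite -[RHS]E.
rewrite mulrBr mulrBl mulr1 mul1r; congr (_ - _).
rewrite mulr_suml mulr_sumr; apply: eq_bigr => i _.
by rewrite -exprSr exprS.
Qed.

(** A subring with a unit [e] of its own, which need not be that of [R], and
    whose elements are nilpotent or invertible. *)
Record local_corner E (e : R) : Prop := LocalCorner {
  lcD : forall x y, E x -> E y -> E (x + y);
  lcN : forall x, E x -> E (- x);
  lcM : forall x y, E x -> E y -> E (x * y);
  lc1 : E e;
  lc_mul1l : forall x, E x -> e * x = x;
  lc_mul1r : forall x, E x -> x * e = x;
  lc_neq0 : e <> 0;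
  lc_nilVunit : forall x, E x ->
    nilpot x \/ exists y, [/\ E y, x * y = e & y * x = e] }.

Section LocalCorner.
Variables (E : set R) (e : R).
Hypothesis lcE : local_corner E e.

Lemma lc0 : E 0.
Proof. by rewrite -(subrr e); apply: (lcD lcE); [|apply: (lcN lcE)]; apply: (lc1 lcE). Qed.

Lemma lcB x y : E x -> E y -> E (x - y).
Proof. by move=> Ex Ey; apply: (lcD lcE) => //; apply: (lcN lcE). Qed.

Lemma lc_sum I (r : seq I) (P : pred I) (f : I -> R) :
  (forall i, P i -> E (f i)) -> E (\sum_(i <- r | P i) f i).
Proof. move=> Ef; apply: (big_ind E) => //; [exact: lc0 | exact: (lcD lcE)]. Qed.

Lemma lcXM x y k : E x -> E y -> E (x ^+ k * y).
Proof.
move=> Ex Ey; elim: k => [|k IH]; first by rewrite mul1r.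
by rewrite exprS -mulrA; apply: (lcM lcE Ex IH).
Qed.

Lemma lcX x k : E x -> E (x ^+ k.+1).
Proof. by move=> Ex; rewrite exprSr; apply: lcXM. Qed.

Lemma lc_nil_not_unit x y : E x -> E y -> nilpot x -> x * y = e -> False.
Proof.
move=> Ex Ey [k xk] xy; apply: (lc_neq0 lcE).
suff <- : x ^+ k * (y ^+ k * e) = e by rewrite xk mul0r.
elim: {xk} k => [|k IH]; first by rewrite !mul1r.
rewrite exprSr exprS -!mulrA (mulrA x y) xy.
by rewrite (lc_mul1l lcE) //; apply: lcXM => //; apply: (lc1 lcE).
Qed.

Lemma lc_nilMr x y : E x -> E y -> nilpot x -> nilpot (x * y).
Proof.
move=> Ex Ey nx; have [//|[z [Ez xyz _]]] := lc_nilVunit lcE (lcM lcE Ex Ey).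
case: (@lc_nil_not_unit x (y * z)) => //; first exact: (lcM lcE Ey Ez).
by rewrite mulrA.
Qed.

Lemma lc_nilMl x y : E x -> E y -> nilpot x -> nilpot (y * x).
Proof. by move=> Ex Ey nx; apply/nilpot_mulC/lc_nilMr. Qed.

(** The nilpotents of a local corner form an ideal, as in a local ring: if
    [x + y] had the inverse [z], then [y * z = e - x * z] would be a nilpotent
    element with an inverse given by a geometric series. *)
Lemma lc_nilD x y : E x -> E y -> nilpot x -> nilpot y -> nilpot (x + y).
Proof.
move=> Ex Ey nx ny; have [//|[z [Ez xyz _]]] := lc_nilVunit lcE (lcD lcE Ex Ey).
have [k xzk] := lc_nilMr Ex Ez nx.
have [xzl _] := nilpot_geometric xzk.
case: (@lc_nil_not_unit y (z * (e * \sum_(i < k) (x * z) ^+ i))) => //.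
  apply: (lcM lcE Ez _); rewrite mulr_sumr; apply: lc_sum => i _.
  case: (nat_of_ord i) => [|j]; first by rewrite mulr1; apply: (lc1 lcE).
  by apply: (lcM lcE (lc1 lcE) _); apply: lcX; apply: (lcM lcE Ex Ez).
have -> : y * (z * (e * \sum_(i < k) (x * z) ^+ i))
          = e * ((1 - x * z) * \sum_(i < k) (x * z) ^+ i).
  rewrite !mulrA; congr (_ * _); rewrite mulrBr mulr1.
  rewrite [e * (_ * _)](lc_mul1l lcE); last exact: (lcM lcE Ex Ez).
  rewrite -mulrA [z * e](lc_mul1r lcE) //.
  by rewrite -xyz mulrDl addrC addKr.
by rewrite xzl mulr1.
Qed.

Lemma lc_nilB x y : E x -> E y -> nilpot x -> nilpot y -> nilpot (x - y).
Proof. by move=> Ex Ey nx ny; apply: lc_nilD => //; [apply: (lcN lcE)|apply: nilpotN]. Qed.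

Lemma lc_nil_sum I (r : seq I) (P : pred I) (f : I -> R) :
  (forall i, P i -> E (f i) /\ nilpot (f i)) -> nilpot (\sum_(i <- r | P i) f i).
Proof.
move=> Ef; suff [] : E (\sum_(i <- r | P i) f i) /\ nilpot (\sum_(i <- r | P i) f i) by [].
apply: (big_ind (fun x => E x /\ nilpot x)) => //.
  by split; [apply: lc0 | apply: nilpot0].
move=> x y [Ex nx] [Ey ny]; split; first exact: (lcD lcE Ex Ey).
exact: lc_nilD.
Qed.

Lemma lc_nil_prime x y : E x -> E y -> nilpot (x * y) -> nilpot x \/ nilpot y.
Proof.
move=> Ex Ey nxy; have [|[z [Ez _ zx]]] := lc_nilVunit lcE Ex; first by left.
right; rewrite -(lc_mul1l lcE Ey) -zx -mulrA.
by apply: lc_nilMl => //; apply: (lcM lcE Ex Ey).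
Qed.

Lemma lc1_not_nil : ~ nilpot e.
Proof.
by move/(nilpot_idem (lc_mul1l lcE (lc1 lcE))); apply: (lc_neq0 lcE).
Qed.

End LocalCorner.
End Nilpotents.

(** * Idempotents of a closed subalgebra *)

Section Fitting.
Variables (K : fieldType) (B : falgType K).

Lemma annihilating_poly (x : B) : exists2 p : {poly K}, p != 0 & horner_alg x p = 0.
Proof.
pose D := \dim {:B}.
pose M := \matrix_(i < D.+1, j < D) coord (vbasis {:B}) j (x ^+ i).
have : kermx M != 0.
  apply/eqP=> k0; have := mxrank_ker M; rewrite k0 mxrank0 => /esym/eqP.
  by rewrite subn_eq0 => /leq_trans/(_ (rank_leq_col M)); rewrite ltnn.
case/rowV0Pn=> v /sub_kermxP vM v0.
exists (\sum_(i < D.+1) v 0 i *: 'X^i).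
  apply: contraNneq v0 => p0; apply/eqP/rowP=> i; rewrite mxE.
  have := congr1 (fun p : {poly K} => p`_i) p0; rewrite coef0 coef_sum => <-.
  rewrite (bigD1 i) //= big1 ?addr0 => [|j ji]; first by rewrite coefZ coefXn eqxx mulr1.
  by rewrite coefZ coefXn eq_sym (negPf ji : (j == i :> nat) = _) mulr0.
rewrite (coord_vbasis (memvf (horner_alg x _))); apply: big1 => j _.
have /matrixP/(_ 0 j) := vM; rewrite mxE [RHS]mxE => vM0.
suff -> : coord (vbasis {:B}) j (horner_alg x (\sum_(i < D.+1) v 0 i *: 'X^i)) = 0.
  by rewrite scale0r.
rewrite -[RHS]vM0 !linear_sum /=; apply: eq_bigr => i _.
by rewrite linearZ /= mulr_algl linearZ /= rmorphXn /= horner_algX mxE.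
Qed.

Lemma horner_alg_comm (x y : B) (p : {poly K}) :
  GRing.comm y x -> GRing.comm y (horner_alg x p).
Proof.
move=> yx; elim/poly_ind: p => [|p c IH]; first by rewrite rmorph0; apply: commr0.
rewrite rmorphD rmorphM /= horner_algX horner_algC.
apply: commrD; first exact: commrM.
by rewrite /GRing.comm mulr_algl mulr_algr.
Qed.

(** An annihilating polynomial [X^m * q(X)] with [q(0) != 0] gives a relation
    [x^N = u * x^N] with [u] a multiple of [x] in [K[x]]; then [u^N] is the
    idempotent of the Fitting component on which [x] is invertible. *)
Lemma fitting (x : B) : exists N g y,
  [/\ (0 < N)%N, g * g = g, x * y = g /\ y * x = g, g * y = y /\ y * g = y
    & g * x ^+ N = x ^+ N].
Proof.
have [p p0 px] := annihilating_poly x.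
have [m [q]] := multiplicity_XsubC p 0; rewrite p0 /= => q0 pE.
have /factor_theorem[r rE] : root (q - q.[0]%:P) 0.
  by rewrite rootE !hornerE subrr.
pose s : B := - q.[0]^-1 *: horner_alg x r.
have xs : x * s = s * x.
  by rewrite -scalerAr -scalerAl horner_alg_comm.
pose u := s * x.
have xu : GRing.comm x u by rewrite /GRing.comm /u mulrA xs.
have su : GRing.comm s u by rewrite /GRing.comm /u -mulrA xs.
have um : u * x ^+ m = x ^+ m.
  move: px; rewrite pE rmorphM rmorphXn /= polyC0 subr0 horner_algX.
  rewrite -[q](subrK q.[0]%:P) rE rmorphD rmorphM /= polyC0 subr0 horner_algX.
  rewrite horner_algC mulrDl mulr_algl => /eqP; rewrite addrC addr_eq0 => /eqP E.
  rewrite /u /s -!scalerAl scaleNr -scalerN -E scalerA mulVf ?scale1r //.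
pose N := m.+1; have uN : u * x ^+ N = x ^+ N by rewrite exprSr mulrA um.
have uk k : u ^+ k * x ^+ N = x ^+ N.
  by elim: k => [|k IH]; rewrite ?mul1r // exprSr -mulrA uN.
have uNE : u ^+ N = s ^+ N * x ^+ N by rewrite exprMn_comm //; exact/esym.
have usN : GRing.comm s (u ^+ N) by apply: commrX.
have gg : u ^+ N * u ^+ N = u ^+ N.
  by rewrite {2}uNE mulrA (commrX N (commr_sym usN)) -mulrA uk -uNE.
have uS : u ^+ N.+1 = u ^+ N by rewrite exprS uNE mulrA (commrX N (commr_sym su)) -mulrA uN.
exists N, (u ^+ N), (s * u ^+ N); split=> //.
- have E : s * u ^+ N * x = u ^+ N.
    by rewrite -mulrA -(commrX N xu) mulrA -/u -exprS uS.
  split=> //; rewrite mulrA xs -/u -exprS //.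
- by split; [rewrite mulrA -usN -mulrA gg | rewrite -mulrA gg].
Qed.

(** The idempotent is [y^N * x^N], where [y] inverts [x] on its Fitting
    component: it is obtained from [x^N] by going backward along the bijection
    of [B] that multiplies this component by [x] and fixes the other one. *)
Lemma zclosed_idempotent n (b : n.-tuple B) (hb : basis_of fullv b) (A : set B) x :
  zclosed b A -> (forall y z, A y -> A z -> A (y * z)) -> A x ->
  exists N g y, [/\ A g, A y, g * g = g, x * y = g /\ y * x = g
    & g * x ^+ N = x ^+ N].
Proof.
move=> clA AM Ax; have [N [g [y [N0 gg [xy yx] [gy yg] gN]]]] := fitting x.
have AX k : A (x ^+ k.+1).
  by elim: k => [|k IH]; rewrite ?expr1 // exprS; apply: AM.
pose T : {linear B -> B} := amull (x * g + 1 - g).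
have TE v : T v = (x * g + 1 - g) * v by rewrite /= lfunE.
have xg : g * x = x * g by rewrite -{1}xy -yx mulrA.
pose T' v := (y + 1 - g) * v.
have TT' : cancel T' T.
  move=> v; rewrite TE /T' mulrA.
  suff -> : (x * g + 1 - g) * (y + 1 - g) = 1 by rewrite mul1r.
  have h : (1 - g) * g = 0 by rewrite mulrBl mul1r gg subrr.
  rewrite -!addrA mulrDl !mulrDr -[x * g * y]mulrA gy xy.
  have -> : (1 - g) * y = 0 by rewrite mulrBl mul1r gy subrr.
  rewrite !mulrN !mulr1 h -mulrA gg subrr subr0 addr0 add0r.
  by rewrite addrCA subrr addr0.
have iterT k m : (N <= m)%N -> iter k T (x ^+ m) = x ^+ (k + m).
  move=> Nm; have gm j : (N <= j)%N -> g * x ^+ j = x ^+ j.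
    by move=> Nj; rewrite -(subnKC Nj) exprD mulrA gN.
  elim: k => //= k ->; rewrite TE mulrBl mulrDl mul1r -mulrA.
  rewrite gm; last by rewrite (leq_trans Nm) ?leq_addl.
  by rewrite addrK -exprS.
have iterT' j : iter j T' (x ^+ N) = y ^+ j * x ^+ N.
  elim: j => [|j IH]; first by rewrite mul1r.
  rewrite iterS IH /T' mulrBl mulrDl mul1r.
  have -> : g * (y ^+ j * x ^+ N) = y ^+ j * x ^+ N.
    rewrite mulrA (_ : g * y ^+ j = y ^+ j * g) -?mulrA ?gN //.
    by apply: commrX; rewrite /GRing.comm gy yg.
  by rewrite addrK mulrA -exprS.
have back j : forall k, A (iter k T (iter j T' (x ^+ N))).
  elim: j => [k|j IH k].
    by rewrite iterT // -(prednK N0) addnS; apply: AX.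
  case: k => [|k]; first by apply: (zclosed_backward hb clA TT' IH).
  by rewrite iterSr iterS TT'; apply: IH.
have yxN : y ^+ N * x ^+ N = g.
  rewrite -exprMn_comm ?yx; last by rewrite /GRing.comm xy yx.
  rewrite -(prednK N0); elim: (N.-1) => [|k IH]; first by rewrite expr1.
  by rewrite exprS IH.
exists N, g, y; split=> //.
- by have := back N 0%N; rewrite iterT' yxN.
- by have := back N.+1 0%N; rewrite iterT' exprS -mulrA yxN yg.
Qed.

End Fitting.

(** * Infinite closed subfields of a power of the field *)

Section Characteristic.
Variables (K : closedFieldType) (p : nat).
Hypothesis pK : p \in [pchar K].

Lemma exprD_frobenius (R : comNzRingType) (pR : p \in [pchar R]) (x y : R) u :
  (x + y) ^+ (p ^ u) = x ^+ (p ^ u) + y ^+ (p ^ u).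
Proof.
apply: exprDn_pchar; rewrite (eq_pnat _ (pcharf_eq pR)) pnatX pnat_id //.
exact: pcharf_prime pR.
Qed.

Lemma expr_frobenius_inj u : injective (fun t : K => t ^+ (p ^ u)).
Proof.
move=> x y /= xy; apply/eqP; rewrite -subr_eq0; apply/eqP.
have p0 : (0 < p ^ u)%N by rewrite expn_gt0 prime_gt0 ?(pcharf_prime pK).
have : (x - y) ^+ (p ^ u) + y ^+ (p ^ u) = 0 + y ^+ (p ^ u).
  by rewrite -exprD_frobenius // subrK add0r.
by move/addIr/eqP; rewrite expf_eq0 p0 => /eqP.
Qed.

Lemma exists_root (t : K) k : (0 < k)%N -> exists s : K, s ^+ k = t.
Proof.
move=> k0; have /closed_rootP[s] : size ('X^k - t%:P : {poly K}) != 1.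
  by rewrite size_XnsubC //; case: k k0.
by rewrite rootE !hornerE subr_eq0 => /eqP; exists s.
Qed.

Lemma poly_fun_eq0 (q : {poly K}) : (forall t, q.[t] = 0) -> q = 0.
Proof.
move=> q0; have : ~~ (size (q - 1%:P) != 1%N).
  apply/negP=> /closed_rootP[t]; rewrite rootE !hornerE q0 sub0r oppr_eq0.
  by rewrite oner_eq0.
rewrite negbK => /size_poly1P [c _ /eqP]; rewrite subr_eq -polyCD => /eqP E.
by move: (q0 0); rewrite E hornerC => ->.
Qed.

(** Writing [a = p^u * a'], the identity holds for [a'] as well; its derivative
    at [0] reads [a' = 0] in [K], unless [a' = 1]. *)
Lemma additive_exponent a : (0 < a)%N ->
  (forall t : K, (t + 1) ^+ a = t ^+ a + 1) -> exists u, a = (p ^ u)%N.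
Proof.
move=> a0 aD; have p_pr := pcharf_prime pK.
have [a' co aE] := pfactor_coprime p_pr a0.
set u := logn p a in aE; exists u.
suff a1 : a' = 1%N by rewrite aE a1 mul1n.
have a'0 : (0 < a')%N by rewrite aE muln_gt0 in a0; case/andP: a0.
have a'D (t : K) : (t + 1) ^+ a' = t ^+ a' + 1.
  have p0 : (0 < p ^ u)%N by rewrite expn_gt0 prime_gt0.
  have [s <-] := exists_root t p0.
  rewrite -[1 in LHS](expr1n _ (p ^ u)) -exprD_frobenius // -!exprM mulnC -aE.
  exact: aD.
have derivXn1 (c : K) k : (('X + c%:P) ^+ k)^`().[0] = c ^+ k.-1 *+ k.
  by rewrite deriv_exp derivD derivX derivC addr0 mul1r hornerMn !hornerE.
pose q : {poly K} := ('X + 1%:P) ^+ a' - ('X + 0%:P) ^+ a' - 1%:P.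
have q0 : q = 0.
  by apply: poly_fun_eq0 => t; rewrite !hornerE a'D addrAC addrK subrr.
have : q^`().[0] = 0 by rewrite q0 deriv0 horner0.
rewrite !derivB derivC subr0 hornerD hornerN !derivXn1 expr1n.
case: (a') co => [|[|k]] //=; first by rewrite /coprime gcdn0 => /eqP p1; rewrite p1 in p_pr.
rewrite prime_coprime // (dvdn_pcharf pK) => /negP kp.
by rewrite expr0n /= mul0rn subr0 => /eqP.
Qed.

Definition monomial k (m : 'I_k -> nat) (v : 'I_k -> K) : K := \prod_i v i ^+ m i.

Lemma monomial_eq0 k (m : 'I_k -> nat) v i : (0 < m i)%N -> v i = 0 -> monomial m v = 0.
Proof. by move=> mi vi; rewrite /monomial (bigD1 i) //= vi expr0n eqn0Ngt mi mul0r. Qed.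

Lemma monomial_neq0 k (m : 'I_k -> nat) v : (forall i, v i != 0) -> monomial m v != 0.
Proof. by move=> v0; apply/prodf_neq0 => i _; rewrite expf_neq0. Qed.

Lemma monomial_single k (m : 'I_k -> nat) v i :
  (forall j, j != i -> v j = 1 \/ m j = 0%N) -> monomial m v = v i ^+ m i.
Proof.
move=> mi; rewrite /monomial (bigD1 i) //= big1 ?mulr1 // => j ji.
by have [->|->] := mi j ji; rewrite ?expr1n.
Qed.

(** The difference of two monomials without common variable is invariant under
    the unit translation only if each of them is a [p]-power of one variable:
    on the coordinate axes, the first monomial has to be additive. *)
Lemma shift_concentrated k (m1 m2 : 'I_k -> nat) i j :
  (forall l, m1 l = 0%N \/ m2 l = 0%N) ->
  (forall v, monomial m1 (fun l => v l + 1) - monomial m2 (fun l => v l + 1)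
             = monomial m1 v - monomial m2 v) ->
  (0 < m1 i)%N -> (0 < m2 j)%N ->
  (forall l, l != i -> m1 l = 0%N) /\ exists u, m1 i = (p ^ u)%N.
Proof.
move=> disj shift mi mj.
have m2i : m2 i = 0%N by case: (disj i) => // mi0; rewrite mi0 in mi.
have m1j : m1 j = 0%N by case: (disj j) => // mj0; rewrite mj0 in mj.
have ji : j != i by apply: contraTneq mi => <-; rewrite m1j.
pose d t (l : 'I_k) : K := if l == i then t else 0.
have shift1 t : monomial m1 (fun l => d t l + 1) = monomial m1 (d t) + 1.
  have := shift (d t); rewrite (@monomial_eq0 _ m2 (d t) j) //; last first.
    by rewrite /d (negPf ji).
  rewrite subr0 => <-; rewrite (@monomial_single _ m2 _ i) ?m2i ?subrK //.
  by move=> l li; left; rewrite /d (negPf li) add0r.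
have dS t : monomial m1 (fun l => d t l + 1) = (t + 1) ^+ m1 i.
  rewrite (@monomial_single _ m1 _ i) /d ?eqxx // => l li; left.
  by rewrite (negPf li) add0r.
have m1l l : l != i -> m1 l = 0%N.
  move=> li; apply/eqP; rewrite -leqn0 leqNgt; apply/negP=> ml.
  have := shift1 (-1); rewrite dS addNr expr0n eqn0Ngt mi /=.
  rewrite (@monomial_eq0 _ m1 _ l) ?/d ?(negPf li) // add0r => /esym/eqP.
  by rewrite oner_eq0.
split=> //; apply: additive_exponent => // t.
rewrite -dS shift1 (@monomial_single _ m1 _ i) /d ?eqxx //.
by move=> l /m1l; right.
Qed.

Lemma meval_monomial k (m : 'X_{1..k}) v : 'X_[m].@[v] = monomial m v.
Proof. by rewrite mevalX. Qed.

Lemma msizeM_drop k (q r : {mpoly K[k]}) a b :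
  (msize q <= a)%N -> (msize r <= b.+1)%N -> (msize (q * r) <= a + b)%N.
Proof.
have [->|q0] := eqVneq q 0; first by rewrite mul0r msize0.
have [->|r0] := eqVneq r 0; first by rewrite mulr0 msize0.
rewrite msizeM //; move: (msize q) (msize r) => u v; lia.
Qed.

Definition shift_mpolys k : k.-tuple {mpoly K[k]} := [tuple 'X_i + 1 | i < k].

Lemma shift_mpolysE k (q : {mpoly K[k]}) v :
  (q \mPo shift_mpolys k).@[v] = q.@[fun i => v i + 1].
Proof.
rewrite comp_mpoly_meval; apply: meval_eq => i.
by rewrite tnth_mktuple mevalD mevalXU meval1.
Qed.

(** Translating the variables does not change the leading form. *)
Lemma msize_shift k (q : {mpoly K[k]}) :
  (msize (q \mPo shift_mpolys k - q) <= (msize q).-1)%N.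
Proof.
pose rel a (f g : {mpoly K[k]}) :=
  [/\ msize f <= a.+1, msize g <= a.+1 & msize (f - g) <= a]%N.
have rel0 : rel 0%N 1 1 by rewrite /rel msize1 subrr msize0.
have relM a c f f' g g' : rel a f f' -> rel c g g' -> rel (a + c)%N (f * g) (f' * g').
  case=> fa f'a ff' [ga g'a gg']; split; [exact: msizeM_leS|exact: msizeM_leS|].
  rewrite (_ : _ - _ = (f - f') * g + (g - g') * f'); last by ring.
  apply: leq_trans (msizeD_le _ _) _; rewrite geq_max msizeM_drop //.
  by rewrite addnC msizeM_drop.
have relX i : rel 1%N ('X_i + 1) 'X_i.
  rewrite /rel addrAC subrr add0r msize1 msizeX mdeg1; split=> //.
  by apply: leq_trans (msizeD_le _ _) _; rewrite msizeX mdeg1 msize1.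
have relXn i d : rel d (('X_i + 1) ^+ d) ('X_i ^+ d).
  by elim: d => [|d IH]; rewrite ?expr0 // !exprS -add1n; apply: relM.
have relm m : rel (mdeg m) ('X_[m] \mPo shift_mpolys k) 'X_[m].
  rewrite comp_mpolyX mpolyXE_id mdegE.
  elim/big_rec3: _ => // i a g f _ IH; apply: relM => //.
  by rewrite tnth_mktuple.
rewrite comp_mpolyEX {3}[q]mpolyE -sumrB.
apply: leq_trans (msize_sum _ _ _) _; apply/bigmax_leqP_seq => m mq _.
rewrite -scalerBr; apply: leq_trans (msizeZ_le _ _) _.
have [_ _ le] := relm m; apply: leq_trans le _.
by move: (msize_mdeg_lt mq); case: (msize q).
Qed.

Section FiniteComplement.
Variables (k : nat) (P : set ('I_k -> K)).
Hypotheses (P1 : P (fun=> 1))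
  (PD : forall x y, P x -> P y -> P (fun i => x i + y i))
  (PM : forall x y, P x -> P y -> P (fun i => x i * y i))
  (Pfield : forall x i, P x -> x i = 0 -> forall j, x j = 0)
  (Pinf : ~ finite_set P).

(** Ignoring finite sets makes this condition stable under division by a
    variable, since only the zero element of the field [P] has zero
    coordinates. *)
Definition almost_vanishing (q : {mpoly K[k]}) : Prop :=
  finite_set [set x | P x /\ q.@[x] <> 0].

Lemma almost_vanishing_shift q :
  almost_vanishing q -> almost_vanishing (q \mPo shift_mpolys k - q).
Proof.
move=> fq; pose s (x : 'I_k -> K) i := x i + 1.
have fs : finite_set (s @^-1` [set x | P x /\ q.@[x] <> 0]).
  apply: finite_preimage => // x y _ _ /funeqP xy.
  by apply/funext => i; apply: (addIr 1); apply: xy.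
apply: sub_finite_set (_ : _ `<=` _) (_ : finite_set (_ `|` _)); last first.
  by rewrite finite_setU; split; [exact: fs | exact: fq].
move=> x [Px]; rewrite mevalB shift_mpolysE => qx.
have [qx0|/eqP qx0] := eqVneq q.@[x] 0; last by right.
left; split; first exact: PD.
by move: qx; rewrite qx0 subr0.
Qed.

Lemma almost_vanishing_twist q y (a : 'X_{1..k}) : P y -> (forall i, y i != 0) ->
  almost_vanishing q ->
  almost_vanishing
    (\sum_(m <- msupp q) (q@_m * (monomial m y - monomial a y)) *: 'X_[m]).
Proof.
move=> Py y0 fq; pose s (x : 'I_k -> K) i := y i * x i.
have fs : finite_set (s @^-1` [set x | P x /\ q.@[x] <> 0]).
  apply: finite_preimage => // x z _ _ /funeqP xz.
  by apply/funext => i; apply: (mulfI (y0 i)); apply: xz.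
apply: sub_finite_set (_ : _ `<=` _) (_ : finite_set (_ `|` _)); last first.
  by rewrite finite_setU; split; [exact: fs | exact: fq].
move=> x [Px]; rewrite (_ : _.@[x] = q.@[s x] - monomial a y * q.@[x]); last first.
  rewrite raddf_sum [q.@[s x]]mevalE [q.@[x]]mevalE mulr_sumr -sumrB; apply: eq_bigr => m _ /=.
  rewrite mevalZ meval_monomial /s.
  have -> : \prod_i (y i * x i) ^+ m i = monomial m y * monomial m x.
    by rewrite /monomial -big_split; apply: eq_bigr => i _; rewrite exprMn.
  by rewrite -/(monomial m x); ring.
have [qx0|/eqP qx0] := eqVneq q.@[x] 0; last by right.
by rewrite qx0 mulr0 subr0 => qx; left; split; first exact: PM.
Qed.

Lemma nonzero_finite : ~ finite_set [set x | P x /\ forall i, x i != 0].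
Proof.
move=> f; apply: Pinf.
apply: sub_finite_set (_ : _ `<=` _) (_ : finite_set (_ `|` [set fun=> 0])); last first.
  by rewrite finite_setU; split; [exact: f | exact: finite_set1].
move=> x Px; have [/existsP[i /eqP xi]|/existsPn x0] := boolP [exists i, x i == 0].
  by right; apply/funext => j; apply: Pfield xi _.
by left; split=> // i; apply: x0.
Qed.

(** Among the nonzero polynomials of least degree that vanish on [P] outside a
    finite set, take one with the fewest monomials.  Combining it with its
    twist by the substitution of [y i * x i] for [x i] removes the monomial
    [b], so the combination is zero: all monomials agree at [y]. *)
Lemma almost_vanishing_binomial q : q != 0 -> almost_vanishing q ->
  exists (d : nat) (a b : 'X_{1..k}),
    [/\ a != b, (mdeg a < d)%N /\ (mdeg b < d)%N,
      forall r, almost_vanishing r -> (msize r < d)%N -> r = 0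
    & forall y, P y -> (forall i, y i != 0) -> monomial a y = monomial b y].
Proof.
move=> q0 fq.
pose S1 d := `[< exists r, [/\ r != 0, almost_vanishing r & msize r = d] >].
have exS1 : exists d, S1 d by exists (msize q); apply/asboolP; exists q.
have [d /asboolP[r [r0 fr rd]] dmin] := ex_minnP exS1.
pose S2 l := `[< exists r, [/\ r != 0, almost_vanishing r, (msize r <= d)%N
                           & size (msupp r) = l] >].
have exS2 : exists l, S2 l.
  by exists (size (msupp r)); apply/asboolP; exists r; rewrite rd.
have [l /asboolP[s [s0 fs sd sl]] lmin] := ex_minnP exS2.
have min r' : almost_vanishing r' -> (msize r' < d)%N -> r' = 0.
  move=> fr' r'd; apply/eqP; apply: contraTT r'd => r'0; rewrite -leqNgt.
  by apply: dmin; apply/asboolP; exists r'.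
have agree a b y : a \in msupp s -> b \in msupp s -> P y ->
    (forall i, y i != 0) -> monomial a y = monomial b y.
  move=> as_ bs Py y0.
  pose t := \sum_(m <- msupp s) (s@_m * (monomial m y - monomial b y)) *: 'X_[m].
  have tE m : t@_m = s@_m * (monomial m y - monomial b y).
    rewrite /t raddf_sum /=.
    have [ms|ms] := boolP (m \in msupp s).
      rewrite (bigD1_seq m) ?msupp_uniq //= big1_seq => [|m' /andP[m'm _]].
        by rewrite addr0 mcoeffZ mcoeffX eqxx mulr1.
      by rewrite mcoeffZ mcoeffX (negPf m'm) mulr0.
    rewrite big1_seq => [|m' /andP[_ m's]].
      by move: ms; rewrite mcoeff_msupp negbK => /eqP ->; rewrite mul0r.
    rewrite mcoeffZ mcoeffX; case: eqP => [m'm|_]; last by rewrite mulr0.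
    by rewrite -m'm m's in ms.
  have ft : almost_vanishing t by apply: almost_vanishing_twist.
  have tsub : {subset msupp t <= rem b (msupp s)}.
    move=> m; rewrite mem_rem_uniq ?msupp_uniq // !inE !mcoeff_msupp tE.
    rewrite mulf_eq0 negb_or => /andP[-> mb]; rewrite andbT.
    by apply: contraNneq mb => ->; rewrite subrr.
  have td : (msize t <= d)%N.
    apply: leq_trans sd; rewrite !msizeE; apply/bigmax_leqP_seq => m mt _.
    by apply: (leq_bigmax_seq (F := fun m : 'X_{1..k} => (mdeg m).+1)) => //;
      apply: mem_rem (tsub _ mt).
  have t0 : t = 0.
    apply/eqP; apply: contraT => tn0.
    have : (l <= size (msupp t))%N by apply: lmin; apply/asboolP; exists t.
    have : (size (msupp t) <= size (rem b (msupp s)))%N.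
      by apply: uniq_leq_size tsub; apply: msupp_uniq.
    rewrite (size_rem bs) => h1 /leq_trans/(_ h1); rewrite -sl.
    by case: (msupp s) bs => // m ms _ /=; rewrite ltnn.
  have := tE a; rewrite t0 mcoeff0 => /esym/eqP; rewrite mulf_eq0.
  by rewrite mcoeff_eq0 as_ subr_eq0 => /eqP.
have sne : msupp s != [::] by rewrite msupp_eq0.
case E : (msupp s) sne => [//|a [|b ms]] _.
  case: nonzero_finite; apply: sub_finite_set fs => x [Px x0]; split=> //.
  rewrite mevalE E big_seq1 => /eqP; rewrite mulf_eq0 mcoeff_eq0 E mem_seq1 eqxx /=.
  by apply/negP; apply: monomial_neq0.
have as_ : a \in msupp s by rewrite E !inE eqxx.
have bs : b \in msupp s by rewrite E !inE eqxx orbT.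
exists d, a, b; split=> //; last by move=> y; apply: agree.
- by have := msupp_uniq s; rewrite E /= inE negb_or -andbA => /andP[].
- by split; [apply: leq_trans (msize_mdeg_lt as_) sd|apply: leq_trans (msize_mdeg_lt bs) sd].
Qed.

(** Cancelling the common variables of the two monomials gives a binomial whose
    unit translation differs from it by a polynomial of lower degree that still
    vanishes on [P] almost everywhere, hence by zero. *)
Lemma frobenius_relation q : q != 0 -> almost_vanishing q ->
  exists i j u w, i != j /\ forall x, P x -> x i ^+ (p ^ u) = x j ^+ (p ^ w).
Proof.
move=> q0 /(almost_vanishing_binomial q0) [d [a [b [ab [ad bd] dmin agree]]]].
pose a' := (a - b)%MM; pose b' := (b - a)%MM.
have a'd : (mdeg a' < d)%N by apply: leq_ltn_trans ad; apply: mdegB.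
have b'd : (mdeg b' < d)%N by apply: leq_ltn_trans bd; apply: mdegB.
have disj l : a' l = 0%N \/ b' l = 0%N.
  by rewrite !mnmBE; case: (leqP (a l) (b l)) => [|/ltnW] /eqP; [left|right].
have agree' y : P y -> (forall i, y i != 0) -> monomial a' y = monomial b' y.
  move=> Py y0; pose c i := minn (a i) (b i).
  apply: (mulIf (monomial_neq0 c y0)).
  have mE (e f g : 'I_k -> nat) : (forall i, e i + f i = g i)%N ->
      monomial e y * monomial f y = monomial g y.
    move=> efg; rewrite /monomial -big_split; apply: eq_bigr => i _ /=.
    by rewrite -exprD efg.
  rewrite (mE a' c a) ?(mE b' c b) ?agree // => i; rewrite mnmBE /c.
    by rewrite addnC -[RHS](subnKC (geq_minr (a i) (b i))); congr (_ + _)%N; lia.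
  by rewrite addnC -[RHS](subnKC (geq_minl (a i) (b i))); congr (_ + _)%N; lia.
pose r : {mpoly K[k]} := 'X_[a'] - 'X_[b'].
have fr : almost_vanishing r.
  rewrite /almost_vanishing.
  apply: sub_finite_set (_ : _ `<=` _) (_ : finite_set [set fun=> 0]); last exact: finite_set1.
  move=> x [Px rx]; have [/existsP[i /eqP xi]|/existsPn x0] := boolP [exists i, x i == 0].
    by apply/funext => j; apply: Pfield xi _.
  by case: rx; rewrite mevalB !meval_monomial agree' ?subrr.
have rd : (msize r <= d)%N.
  by apply: leq_trans (msizeD_le _ _) _; rewrite msizeN !msizeX geq_max a'd.
have shift v : monomial a' (fun l => v l + 1) - monomial b' (fun l => v l + 1)
             = monomial a' v - monomial b' v.
  have : r \mPo shift_mpolys k - r = 0.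
    apply: dmin; first exact: almost_vanishing_shift.
    apply: leq_ltn_trans (msize_shift _) _; 
    by have := leq_ltn_trans (leq0n _) a'd; case: (msize r) rd.
  move/(congr1 (fun f => f.@[v])); rewrite meval0 mevalB shift_mpolysE.
  by rewrite !mevalB !meval_monomial => /eqP; rewrite subr_eq0 => /eqP.
have zero_or (m : 'I_k -> nat) : (forall i, m i = 0%N) \/ exists i, (0 < m i)%N.
  have [/existsP[i]|/existsPn m0] := boolP [exists i, (0 < m i)%N]; first by right; exists i.
  by left=> i; have := m0 i; rewrite -leqNgt leqn0 => /eqP.
have monomial1 (m : 'I_k -> nat) : monomial m (fun=> 0 + 1) = 1.
  by rewrite /monomial big1 // => i _; rewrite add0r expr1n.
have shift0 := shift (fun=> 0); rewrite !monomial1 subrr in shift0.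
have mono0 (m : 'I_k -> nat) : (forall i, m i = 0%N) -> monomial m (fun=> 0) = 1.
  by move=> m0; rewrite /monomial big1 // => i _; rewrite m0.
have [a0|[i ai]] := zero_or a'; have [b0|[j bj]] := zero_or b'.
- case/eqP: ab; apply/mnmP => i.
  have := a0 i; have := b0 i; rewrite !mnmBE => /eqP ba /eqP ab.
  by apply/eqP; rewrite eqn_leq; apply/andP; split.
- move: shift0; rewrite mono0 // (@monomial_eq0 _ b' _ j) // subr0 => /esym/eqP.
  by rewrite oner_eq0.
- move: shift0; rewrite [X in _ - X]mono0 // (@monomial_eq0 _ a' _ i) // sub0r.
  by move=> /esym/eqP; rewrite oppr_eq0 oner_eq0.
have [a1 [u au]] := shift_concentrated disj shift ai bj.
have disj' l : b' l = 0%N \/ a' l = 0%N by case: (disj l); [right|left].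
have shift' v : monomial b' (fun l => v l + 1) - monomial a' (fun l => v l + 1)
             = monomial b' v - monomial a' v.
  by rewrite -[LHS]opprB shift opprB.
have [b1 [w bw]] := shift_concentrated disj' shift' bj ai.
exists i, j, u, w; split.
  by apply: contraTneq bj => <-; rewrite -leqNgt; case: (disj i) ai => ->.
move=> x Px; rewrite -au -bw.
have [/existsP[l /eqP xl]|/existsPn x0] := boolP [exists i, x i == 0].
  by rewrite !(Pfield Px xl) !expr0n !eqn0Ngt ai bj.
have := agree' _ Px x0.
rewrite (@monomial_single _ _ _ i) ?(@monomial_single _ _ _ j) //.
  by move=> l /b1; right.
by move=> l /a1; right.
Qed.

End FiniteComplement.

(** An algebraic relation between the coordinates makes one of them a Frobenius
    power of another one, so that it can be dropped.  A field [P] that satisfies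
    no relation is the whole space, which is a field only in dimension one. *)
Lemma frobenius_curve k (P : set ('I_k.+1 -> K)) :
  (forall v, (forall q : {mpoly K[k.+1]}, (forall x, P x -> q.@[x] = 0) -> q.@[v] = 0) ->
    P v) ->
  P (fun=> 1) ->
  (forall x y, P x -> P y -> P (fun i => x i + y i)) ->
  (forall x y, P x -> P y -> P (fun i => x i * y i)) ->
  (forall x i, P x -> x i = 0 -> forall j, x j = 0) ->
  ~ finite_set P ->
  exists a : 'I_k.+1 -> nat, forall x, P x <-> exists t, forall i, x i = t ^+ (p ^ a i).
Proof.
elim: k P => [|k IH] P clP P1 PD PM Pfield Pinf.
  have [[q [q0 fq]]|noq] := pselect (exists q : {mpoly K[1]}, q != 0 /\ almost_vanishing P q).
    have [i [j [u [w [ij _]]]]] := frobenius_relation P1 PD PM Pfield Pinf q0 fq.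
    by rewrite !ord1 eqxx in ij.
  exists (fun=> 0%N) => x; split=> [_|_]; last first.
    apply: clP => q qP; have [->|q0] := eqVneq q 0; first by rewrite meval0.
    case: noq; exists q; split=> //; apply: sub_finite_set (finite_set0 _).
    by move=> y [/qP].
  by exists (x 0) => i; rewrite ord1 expr1.
have [[q [q0 fq]]|noq] := pselect (exists q : {mpoly K[k.+2]}, q != 0 /\ almost_vanishing P q);
  last first.
  pose x (i : 'I_k.+2) : K := (i == ord0)%:R.
  suff Px : P x.
    have := Pfield x ord_max Px erefl ord0; rewrite /x eqxx => /eqP.
    by rewrite oner_eq0.
  apply: clP => q qP; have [->|q0] := eqVneq q 0; first by rewrite meval0.
  case: noq; exists q; split=> //; apply: sub_finite_set (finite_set0 _).
  by move=> y [/qP].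
have [i [j [w [ij rij]]]] :
    exists i j w, i != j /\ forall x, P x -> x i = x j ^+ (p ^ w).
  have [i [j [u [w [ij rij]]]]] := frobenius_relation P1 PD PM Pfield Pinf q0 fq.
  have [uw|/ltnW wu] := leqP u w.
    exists i, j, (w - u)%N; split=> // x Px; apply: (@expr_frobenius_inj u).
    by rewrite /= rij // -exprM -expnD subnK.
  exists j, i, (u - w)%N; rewrite eq_sym; split=> // x Px.
  by apply: (@expr_frobenius_inj w); rewrite /= -rij // -exprM -expnD subnK.
have [j' jE] : exists j', j = lift i j'.
  by case: (unliftP i j) => [j' ->|ji]; [exists j' | rewrite ji eqxx in ij].
pose ext (x : 'I_k.+1 -> K) l :=
  if unlift i l is Some l' then x l' else x j' ^+ (p ^ w).
have extl x l : ext x (lift i l) = x l by rewrite /ext liftK.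
have exti x : ext x i = x j' ^+ (p ^ w) by rewrite /ext unlift_none.
have Pext x : P x -> x = ext (fun l => x (lift i l)).
  move=> Px; apply/funext => l; rewrite /ext; case: unliftP => [l' -> //|->].
  by rewrite -jE; apply: rij.
have p0 : (0 < p ^ w)%N by rewrite expn_gt0 prime_gt0 ?(pcharf_prime pK).
have [||||||a aP] := IH (fun x => P (ext x)).
- clear q q0 fq; move=> v hv; apply: clP => q qP.
  pose lq := [tuple if unlift i l is Some l' then 'X_l' else 'X_j' ^+ (p ^ w)
              | l < k.+2] : _.-tuple {mpoly K[k.+1]}.
  have lqE x : (q \mPo lq).@[x] = q.@[ext x].
    rewrite comp_mpoly_meval; apply: meval_eq => l.
    rewrite tnth_mktuple /ext; case: unlift => [l'|]; first by rewrite mevalXU.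
    by rewrite rmorphXn /= mevalXU.
  by rewrite -lqE; apply: hv => x Px; rewrite lqE; apply: qP.
- suff -> : ext (fun=> 1) = fun=> 1 by [].
  by apply/funext => l; rewrite /ext; case: unlift; rewrite ?expr1n.
- move=> x y Px Py; suff -> : ext (fun l => x l + y l) = fun l => ext x l + ext y l.
    exact: PD.
  by apply/funext => l; rewrite /ext; case: unlift => //; rewrite exprD_frobenius.
- move=> x y Px Py; suff -> : ext (fun l => x l * y l) = fun l => ext x l * ext y l.
    exact: PM.
  by apply/funext => l; rewrite /ext; case: unlift => //; rewrite exprMn.
- move=> x l Px xl l'; rewrite -extl; apply: (Pfield _ (lift i l)) => //.
  by rewrite extl.
- move=> f; apply: Pinf; apply: sub_finite_set (finite_image ext f).
  by move=> x Px; exists (fun l => x (lift i l)); rewrite -?Pext.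
exists (fun l => if unlift i l is Some l' then a l' else (a j' + w)%N) => x.
split=> [Px|[t xt]].
  have [|t xt] := (aP (fun l => x (lift i l))).1; first by rewrite -Pext.
  exists t => l; rewrite {1}(Pext x Px) /ext; case: unlift => [l'|]; first exact: xt.
  by rewrite xt -exprM -expnD.
have -> : x = ext (fun l => t ^+ (p ^ a l)).
  apply/funext => l; rewrite xt /ext; case: unlift => // .
  by rewrite expnD exprM.
by apply/aP; exists t.
Qed.

End Characteristic.

(** * Orthogonal idempotents and diagonalization *)

Section OrthogonalIdempotents.
Variables (K : fieldType) (B : falgType K).

Record orth_idem (I : finType) (f : I -> B) : Prop := OrthIdem {
  oi_mul : forall i, f i * f i = f i;
  oi_orth : forall i j, i != j -> f i * f j = 0;
  oi_neq0 : forall i, f i != 0 }.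

Lemma oi_mulE (I : finType) (f : I -> B) i j :
  orth_idem f -> f i * f j = if i == j then f i else 0.
Proof. by move=> oi; case: eqP => [<-|/eqP ij]; [apply: oi_mul|apply: oi_orth]. Qed.

Definition spanc (I : finType) (f : I -> B) (c : I -> K) : B := \sum_i c i *: f i.

Section Span.
Variables (I : finType) (f : I -> B).
Hypothesis oi : orth_idem f.

Lemma spanc_mull i c : f i * spanc f c = c i *: f i.
Proof.
rewrite /spanc mulr_sumr (bigD1 i) //= big1 ?addr0 => [|j ji].
  by rewrite -scalerAr (oi_mul oi).
by rewrite -scalerAr (oi_orth oi) ?scaler0 // eq_sym.
Qed.

Lemma spanc_mulr i c : spanc f c * f i = c i *: f i.
Proof.
rewrite /spanc mulr_suml (bigD1 i) //= big1 ?addr0 => [|j ji].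
  by rewrite -scalerAl (oi_mul oi).
by rewrite -scalerAl (oi_orth oi) ?scaler0.
Qed.

Lemma spanc_inj c d : spanc f c = spanc f d -> c =1 d.
Proof.
move=> cd i; have /eqP := congr1 (fun x => f i * x) cd.
rewrite !spanc_mull -subr_eq0 -scalerBl scaler_eq0 (negPf (oi_neq0 oi i)) orbF.
by rewrite subr_eq0 => /eqP.
Qed.

Lemma spancM c d : spanc f c * spanc f d = spanc f (fun i => c i * d i).
Proof.
rewrite {1}/spanc mulr_suml; apply: eq_bigr => i _.
by rewrite -scalerAl spanc_mull scalerA.
Qed.

Lemma spancD c d : spanc f c + spanc f d = spanc f (fun i => c i + d i).
Proof. by rewrite /spanc -big_split; apply: eq_bigr => i _; rewrite scalerDl. Qed.

Lemma spancZ t c : t *: spanc f c = spanc f (fun i => t * c i).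
Proof. by rewrite /spanc scaler_sumr; apply: eq_bigr => i _; rewrite scalerA. Qed.

Lemma spanc0 : spanc f (fun=> 0) = 0.
Proof. by rewrite /spanc big1 // => i _; rewrite scale0r. Qed.

Lemma spancXS c k : spanc f c ^+ k.+1 = spanc f (fun i => c i ^+ k.+1).
Proof.
elim: k => [|k IH]; first by rewrite expr1; apply: eq_bigr => i _; rewrite expr1.
by rewrite exprS IH spancM; apply: eq_bigr => i _; rewrite -exprS.
Qed.

Lemma orth_idem_card : (#|I| <= \dim {:B})%N.
Proof.
have fr : free [seq f i | i <- enum I].
  have sz : size [seq f i | i <- enum I] == #|I| by rewrite size_map -cardE.
  suff : free (Tuple sz) by [].
  apply/freeP => c c0 i.
  suff /spanc_inj/(_ (enum_val i)) : spanc f (fun x => c (enum_rank x)) = spanc f (fun=> 0).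
    by rewrite enum_valK.
  rewrite spanc0 -[RHS]c0 /spanc (reindex (@enum_val I I)) /=; last exact: onW_bij (enum_val_bij I).
  apply: eq_bigr => j _; rewrite enum_valK; congr (_ *: _).
  by rewrite (nth_map (enum_val j)) -?cardE // -enum_val_nth.
have := dimvS (subvf <<[seq f i | i <- enum I]>>%VS).
by rewrite (eqnP fr) size_map -cardE.
Qed.

End Span.

(** Orthogonal nonzero idempotents are linearly independent. *)
Lemma orth_idem_max (Q : forall I : finType, (I -> B) -> Prop) (I0 : finType) f0 :
  (forall (I : finType) f, Q I f -> orth_idem f) -> Q I0 f0 ->
  exists (I : finType) f, Q I f /\ forall (J : finType) g, Q J g -> (#|J| <= #|I|)%N.
Proof.
move=> Qoi Q0; pose S d := `[< exists (I : finType) f, Q I f /\ #|I| = d >].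
have exS : exists d, S d by exists #|I0|; apply/asboolP; exists I0, f0.
have bS d : S d -> (d <= \dim {:B})%N.
  by move=> /asboolP [I [f [/Qoi oi <-]]]; apply: orth_idem_card oi.
have [d /asboolP[I [f [Qf <-]]] dmax] := ex_maxnP exS bS.
by exists I, f; split=> // J g Qg; apply: dmax; apply/asboolP; exists J, g.
Qed.

End OrthogonalIdempotents.

Lemma exprB_frobenius_comm (R : nzRingType) (p : nat) (pR : p \in [pchar R]) (x y : R) u :
  GRing.comm x y -> (x - y) ^+ (p ^ u) = x ^+ (p ^ u) - y ^+ (p ^ u).
Proof.
move=> xy; elim: u => [|u IH]; first by rewrite !expr1.
rewrite !expnSr !exprM IH -!(pFrobenius_autE pR) pFrobenius_autB_comm //.
by apply/commrX/commr_sym/commrX.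
Qed.

Section Spectral.
Variables (K : closedFieldType) (B : falgType K) (p : nat).
Hypothesis pK : p \in [pchar K].

Lemma pchar_falg : p \in [pchar B].
Proof. by rewrite pchar_lalg. Qed.

(** The Lagrange interpolation polynomials at the eigenvalues, evaluated at a
    root of a separable split polynomial, are its spectral idempotents. *)
Lemma spectral_idempotents r (mu : 'I_r -> K) (s : B) : injective mu ->
  \prod_j (s - (mu j)%:A) = 0 ->
  exists eta : 'I_r -> B,
    [/\ forall i j, eta i * eta j = if i == j then eta i else 0, \sum_j eta j = 1,
      s = \sum_j mu j *: eta j & forall y, GRing.comm y s -> forall j, GRing.comm y (eta j)].
Proof.
move=> mu_inj sM.
pose L j : {poly K} :=
  (\prod_(i | i != j) (mu j - mu i))^-1 *: \prod_(i | i != j) ('X - (mu i)%:P).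
have hs t : horner_alg s ('X - t%:P) = s - t%:A.
  by rewrite rmorphB /= horner_algX horner_algC.
have Ls j : (s - (mu j)%:A) * horner_alg s (L j) = 0.
  have LE : ('X - (mu j)%:P) * L j
    = (\prod_(i | i != j) (mu j - mu i))^-1 *: \prod_i ('X - (mu i)%:P).
    by rewrite /L -scalerAr [X in _ = _ *: X](bigD1 j).
  rewrite -hs -rmorphM /= LE linearZ /= rmorph_prod.
  by rewrite (eq_bigr _ (fun i _ => hs (mu i))) sM mulr0.
have Lorth i j : i != j -> horner_alg s (L i) * horner_alg s (L j) = 0.
  move=> ij.
  have [q qE] : exists q, L i = q * ('X - (mu j)%:P).
    rewrite /L [X in _ *: X](bigD1 j) /= 1?eq_sym // [X in _ *: X]mulrC scalerAl.
    by eexists.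
  by rewrite qE rmorphM /= hs -mulrA Ls mulr0.
have r0 : (0 < r)%N.
  case: (r) mu sM {L hs Ls Lorth mu_inj} => // mu /eqP.
  by rewrite big_ord0 oner_eq0.
have sumL : \sum_j L j = 1.
  apply/eqP; rewrite -subr_eq0; apply/eqP.
  apply: (@roots_geq_poly_eq0 _ _ [seq mu j | j <- enum 'I_r]).
  - apply/allP=> _ /mapP[j _ ->]; rewrite rootE hornerD hornerN hornerC horner_sum.
    have LE i t : (L i).[t] =
        (\prod_(l | l != i) (mu i - mu l))^-1 * \prod_(l | l != i) (t - mu l).
      rewrite /L hornerZ horner_prod; congr (_ * _); apply: eq_bigr => l _.
      by rewrite !hornerE.
    rewrite (bigD1 j) //= big1 => [|i ij].
      rewrite addr0 LE mulVf ?subrr //; apply/prodf_neq0 => i ij.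
      by rewrite subr_eq0; apply: contra ij => /eqP/mu_inj ->.
    by rewrite LE [X in _ * X](bigD1 j) 1?eq_sym //= subrr mul0r mulr0.
  - by rewrite map_inj_uniq ?enum_uniq.
  rewrite size_map size_enum_ord; apply: leq_trans (size_polyD _ _) _.
  rewrite size_polyN size_poly1 geq_max r0 andbT.
  apply: leq_trans (size_sum _ _ _) _; apply/bigmax_leqP => j _.
  apply: leq_trans (size_scale_leq _ _) _.
  rewrite -big_filter size_prod_XsubC size_filter -sum1_count /=.
  suff : (\sum_(i in predC1 j) 1 < r)%N by [].
  by rewrite sum1_card cardC1 card_ord prednK.
have sume : \sum_j horner_alg s (L j) = 1 by rewrite -rmorph_sum /= sumL rmorph1.
exists (fun j => horner_alg s (L j)); split=> //.
- move=> i j; case: eqP => [<-|/eqP]; last exact: Lorth.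
  rewrite -[RHS]mulr1 -sume mulr_sumr (bigD1 i) //= big1 ?addr0 // => l li.
  by apply: Lorth; rewrite eq_sym.
- rewrite -[LHS]mulr1 -sume mulr_sumr; apply: eq_bigr => j _.
  by apply/eqP; rewrite -mulr_algl -subr_eq0 -mulrBl Ls.
by move=> y ys j; apply: horner_alg_comm.
Qed.

(** A Frobenius power beyond the multiplicities of an annihilating polynomial
    makes it separable. *)
Lemma frobenius_diagonalizable (x : B) : exists k r (mu : 'I_r -> K),
  injective mu /\ \prod_j (x ^+ (p ^ k) - (mu j)%:A) = 0.
Proof.
have [q q0 qx] := annihilating_poly x.
have [rs qE] := closed_field_poly_normal q.
pose ds := undup rs; pose k := size rs.
pose Q : {poly K} := \prod_(z <- ds) ('X - z%:P).
have qQ l : {subset l <= ds} -> \prod_(z <- l) ('X - z%:P) %| Q ^+ size l.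
  elim: l => [|z l IH] sub; first by rewrite big_nil dvd1p.
  rewrite big_cons exprS dvdp_mul ?IH //; last by move=> y yl; apply: sub; rewrite inE yl orbT.
  by rewrite /Q (big_rem z) ?dvdp_mulIl //=; apply: sub; rewrite inE eqxx.
have p1 : (1 < p)%N := prime_gt1 (pcharf_prime pK).
have Qx : horner_alg x (Q ^+ (p ^ k)) = 0.
  have : q %| Q ^+ (p ^ k).
    rewrite qE dvdpZl ?lead_coef_eq0 //.
    apply: dvdp_trans (qQ _ _) (dvdp_exp2l _ (ltnW (ltn_expl _ p1))).
    by move=> z; rewrite mem_undup.
  by case/dvdpP => t ->; rewrite rmorphM /= qx mulr0.
exists k, (size ds), (fun j => ds`_j ^+ (p ^ k)); split.
  move=> i j /(expr_frobenius_inj pK)/eqP; rewrite nth_uniq ?undup_uniq //.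
  by move/eqP/val_inj.
have pP : p \in [pchar {poly K}] by rewrite pchar_poly.
rewrite -[RHS]Qx /Q (big_nth 0) big_mkord -prodrXl rmorph_prod.
apply: eq_bigr => j _ /=.
rewrite (exprB_frobenius_comm pP); last exact: mulrC.
by rewrite rmorphB /= -polyC_exp horner_algC rmorphXn /= horner_algX.
Qed.

End Spectral.

(** * Isotypic decomposition under an element of finite order *)

Definition corner (R : nzRingType) (A : set R) (e : R) : set R :=
  [set x | [/\ A x, e * x = x & x * e = x]].

Lemma nilpot_scale (K : fieldType) (B : falgType K) (t : K) (x : B) :
  nilpot x -> nilpot (t *: x).
Proof. by case=> k xk; exists k; rewrite exprZn xk scaler0. Qed.

Section RootOfUnity.
Variables (K : fieldType) (B : falgType K) (E : set B) (e w : B) (Q : nat).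
Hypotheses (lcE : local_corner E e) (EV : forall k x, E x -> E ((k%:R^-1 : K) *: x)).
Hypotheses (Ew : E w) (Q0 : (0 < Q)%N) (QK : Q%:R != 0 :> K).
Hypotheses (wQ : w ^+ Q = e) (w_unit : forall k, (0 < k < Q)%N -> ~ nilpot (w ^+ k - e)).

Lemma expw_mod k y : E y -> w ^+ (k %% Q) * y = w ^+ k * y.
Proof.
move=> Ey; rewrite [in RHS](divn_eq k Q) exprD mulnC exprM wQ.
have Ewy : E (w ^+ (k %% Q) * y) by apply: (lcXM lcE).
rewrite -mulrA; elim: (k %/ Q)%N => [|l IH]; first by rewrite mul1r.
by rewrite exprSr -mulrA (lc_mul1l lcE).
Qed.

Lemma expw_modr k y : E y -> y * w ^+ (k %% Q) = y * w ^+ k.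
Proof.
move=> Ey; rewrite -(lc_mul1r lcE Ey) -!mulrA; congr (_ * _).
have comm l : e * w ^+ l = w ^+ l * e.
  by apply: commrX; rewrite /GRing.comm (lc_mul1l lcE Ew) (lc_mul1r lcE Ew).
by rewrite !comm expw_mod //; apply: (lc1 lcE).
Qed.

(** The sum is invariant under [w ^+ m], and [w ^+ m - e] is invertible. *)
Lemma geometric_eq0 m y : E y -> (m %% Q != 0)%N -> \sum_(k < Q) w ^+ (m * k) * y = 0.
Proof.
move=> Ey mQ; set S := \sum_(k < Q) _.
have ES : E S by apply: (lc_sum lcE) => k _; apply: (lcXM lcE).
have wS : w ^+ m * S = S.
  rewrite /S mulr_sumr; case: (Q) Q0 (expw_mod (m * Q) Ey) => // q _ wmQ.
  rewrite big_ord_recr [RHS]big_ord_recl /= muln0 addrC; congr (_ + _).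
    by rewrite mulrA -exprD -mulnS -wmQ modnMl.
  by apply: eq_bigr => k _; rewrite mulrA -exprD -mulnS.
have Ewm : E (w ^+ (m %% Q)) by case: (m %% Q)%N mQ => // k _; apply: (lcX lcE).
have mQ' : (0 < m %% Q < Q)%N by rewrite lt0n mQ ltn_pmod.
have Eu : E (w ^+ (m %% Q) - e) by apply: (lcB lcE) => //; apply: (lc1 lcE).
have [/(w_unit mQ')//|[z [Ez _ zu]]] := lc_nilVunit lcE Eu.
rewrite -[LHS](lc_mul1l lcE ES) -zu -mulrA mulrBl expw_mod // wS.
by rewrite (lc_mul1l lcE) // subrr mulr0.
Qed.

(** The projection of [y] on [{z | w ^+ c * z = z * w}]. *)
Definition isotypic (c : nat) (y : B) : B :=
  (Q%:R^-1 : K) *: \sum_(k < Q) w ^+ (c * k) * y * w ^+ (Q.-1 * k).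

Lemma isotypic_in c y : E y -> E (isotypic c y).
Proof.
move=> Ey; apply: EV; apply: (lc_sum lcE) => k _.
have : E (w ^+ (c * k) * y) by apply: (lcXM lcE).
elim: (Q.-1 * k)%N => [|l IH] Ez; first by rewrite mulr1.
by rewrite exprSr mulrA; apply: (lcM lcE) => //; apply: IH.
Qed.

Lemma isotypic_comm c y : E y -> w ^+ c * isotypic c y = isotypic c y * w.
Proof.
move=> Ey; rewrite -scalerAr -scalerAl; congr (_ *: _).
rewrite mulr_sumr mulr_suml.
pose t k := w ^+ (c * k.+1) * y * w ^+ (Q.-1 * k).
rewrite (eq_bigr (fun k : 'I_Q => t k)) => [|k _]; last first.
  by rewrite !mulrA -exprD -mulnS.
pose s k := w ^+ (c * k) * y * w ^+ (Q.-1 * k).+1.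
rewrite [RHS](eq_bigr (fun k : 'I_Q => s k)) => [|k _]; last first.
  by rewrite /s exprSr !mulrA.
have EX k : E (w ^+ k * y) by apply: (lcXM lcE).
have ts k : t k = s k.+1.
  rewrite /t /s -expw_modr // -[RHS]expw_modr //; congr (_ * w ^+ _).
  have -> : ((Q.-1 * k.+1).+1 = Q + Q.-1 * k)%N by rewrite mulnS -addSn prednK.
  by rewrite modnDl.
have sQ : s Q = s 0%N.
  rewrite /s muln0 -[X in X * _ = _](expw_mod _ Ey) modnMl.
  by rewrite -expw_modr // -[RHS]expw_modr // -addn1 modnMDl muln0.
rewrite (eq_bigr _ (fun (k : 'I_Q) _ => ts k)).
case: (Q) Q0 sQ => // q _ sQ.
by rewrite big_ord_recr [RHS]big_ord_recl /= sQ addrC.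
Qed.

Lemma isotypic_sum y : E y -> y = \sum_(c < Q) isotypic c y.
Proof.
move=> Ey; rewrite -scaler_sumr exchange_big /=.
have inner k : (0 < k < Q)%N ->
    \sum_(c < Q) w ^+ (c * k) * y * w ^+ (Q.-1 * k) = 0.
  move=> kQ; rewrite -mulr_suml (eq_bigr (fun c : 'I_Q => w ^+ (k * c) * y)).
    by rewrite geometric_eq0 ?mul0r // modn_small -?lt0n //; case/andP: kQ.
  by move=> c _; rewrite mulnC.
move: inner; case: (Q) Q0 QK => // q _ qK inner.
rewrite big_ord_recl [X in _ + X]big1 ?addr0 => [|k _]; last by apply: inner; case: k.
rewrite (eq_bigr (fun=> y)) => [|c _]; last by rewrite !muln0 mul1r mulr1.
by rewrite sumr_const card_ord -scaler_nat scalerA mulVf ?scale1r.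
Qed.

Definition proj1w := isotypic 1.

Lemma proj1w_eq0 c y : E y -> w ^+ c * y = y * w -> (c != 1 %[mod Q])%N -> proj1w y = 0.
Proof.
move=> Ey cy c1; apply/eqP; rewrite /proj1w /isotypic scaler_eq0; apply/orP; right.
have cyk k : y * w ^+ k = w ^+ (c * k) * y.
  elim: k => [|k IH]; first by rewrite muln0 mul1r mulr1.
  by rewrite exprSr mulrA IH -mulrA -cy mulrA -exprD mulnS addnC.
apply/eqP; rewrite -[RHS](@geometric_eq0 (1 + c * Q.-1) y) //.
  by apply: eq_bigr => k _; rewrite -mulrA cyk mulrA -exprD mulnDl mulnA.
apply: contra c1 => /eqP h; rewrite -(eqn_modDr (c * Q.-1)).
by rewrite h -mulnS prednK // modnMl.
Qed.

Lemma proj1w_id y : E y -> w * y = y * w -> proj1w y = y.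
Proof.
move=> Ey cy; rewrite /proj1w /isotypic (eq_bigr (fun=> y)) => [|k _].
  by rewrite sumr_const card_ord -scaler_nat scalerA mulVf ?scale1r.
have -> : w ^+ (1 * k) * y * w ^+ (Q.-1 * k) = y * w ^+ (Q * k).
  rewrite mul1n (_ : w ^+ k * y = y * w ^+ k) -?mulrA -?exprD.
    by rewrite -{1}[k : nat]mul1n -mulnDl add1n prednK.
  by apply/commr_sym/commrX.
by rewrite -expw_modr // modnMr mulr1.
Qed.

Lemma proj1wD x y : proj1w (x + y) = proj1w x + proj1w y.
Proof.
rewrite /proj1w /isotypic -scalerDr -big_split; congr (_ *: _).
by apply: eq_bigr => k _ /=; rewrite mulrDr mulrDl.
Qed.

Lemma proj1w_nil y : E y -> nilpot y -> nilpot (proj1w y).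
Proof.
move=> Ey ny; apply: nilpot_scale; apply: (lc_nil_sum lcE) => k _.
have EX l z : E z -> nilpot z -> E (w ^+ l * z) /\ nilpot (w ^+ l * z).
  move=> Ez nz; elim: l => [|l [Ew' nw]]; first by rewrite mul1r.
  rewrite exprS -mulrA; split; first exact: (lcM lcE).
  exact: (lc_nilMl lcE).
have [Ez nz] := EX (1 * k)%N y Ey ny.
elim: (Q.-1 * k)%N => [|l [Ew' nw]]; first by rewrite mulr1.
rewrite exprSr mulrA; split; first exact: (lcM lcE).
exact: (lc_nilMr lcE).
Qed.

End RootOfUnity.

(** * Maximal tori of a local corner *)

Section Torus.
Variables (K : closedFieldType) (B : falgType K) (p : nat).
Hypothesis pK : p \in [pchar K].
Variables (n : nat) (b : n.-tuple B) (A : set B) (e : B).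
Hypothesis clA : zclosed b A.
Notation E := (corner A e).
Hypothesis lcE : local_corner E e.

(** The torus is the set of elements of [E] in the span of the [f i]; the last
    condition makes its centralizer the centralizer of all [f i]. *)
Record torus (I : finType) (f : I -> B) : Prop := Torus {
  torus_oi : orth_idem f;
  torus_sum : \sum_i f i = e;
  torus_sep : forall i j, i != j -> exists c, E (spanc f c) /\ c i != c j }.

Let p0 u : (0 < p ^ u)%N.
Proof. by rewrite expn_gt0 prime_gt0 ?(pcharf_prime pK). Qed.

Lemma torus_unit (I : finType) (f : I -> B) i : torus f -> e * f i = f i /\ f i * e = f i.
Proof.
move=> tf; have oi := torus_oi tf; rewrite -(torus_sum tf) mulr_suml mulr_sumr.
split; rewrite (bigD1 i) //= big1 ?addr0 ?(oi_mul oi) // => j ji.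
  by rewrite (oi_orth oi).
by rewrite (oi_orth oi) // eq_sym.
Qed.

Lemma torus_max : exists k (f : 'I_k.+1 -> B), torus f /\
  forall (J : finType) (g : J -> B), torus g -> (#|J| <= k.+1)%N.
Proof.
have t1 : @torus unit (fun=> e).
  split.
  - split=> [i|[] []|i] //; first by rewrite (lc_mul1l lcE) //; apply: (lc1 lcE).
    by apply/eqP; apply: (lc_neq0 lcE).
  - by rewrite big_const card_unit /= addr0.
  - by move=> [] [].
have [I [f [tf fmax]]] := orth_idem_max torus_oi t1.
pose g (i : 'I_#|I|) : B := f (enum_val i).
have spang c : spanc g (fun i => c (enum_val i)) = spanc f c.
  by rewrite /spanc [RHS](reindex (@enum_val I I)) //=; apply: onW_bij (enum_val_bij I).
have tg : torus g.
  have [oi sm sep] := tf; split.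
  - split=> [i|i j ij|i]; [exact: (oi_mul oi)| |exact: (oi_neq0 oi)].
    by apply: (oi_orth oi); apply: contra ij => /eqP/enum_val_inj ->.
  - by rewrite -[RHS]sm [RHS](reindex (@enum_val I I)) //=; apply: onW_bij (enum_val_bij I).
  - move=> i j ij; have [|c [Ec cij]] := sep (enum_val i) (enum_val j).
      by apply: contra ij => /eqP/enum_val_inj ->.
    by exists (fun i => c (enum_val i)); rewrite spang.
move: g tg {spang} fmax; case: #|I| => [g tg _|k g tg fmax].
  by case: (lc_neq0 lcE); rewrite -(torus_sum tg) big_ord0.
by exists k, g.
Qed.

Variables (k : nat) (f : 'I_k.+1 -> B).
Hypotheses (tf : torus f)
  (fmax : forall (J : finType) (g : J -> B), torus g -> (#|J| <= k.+1)%N).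
Let oi := torus_oi tf.

(** The torus, seen as a closed subset of the affine space of dimension
    [k.+1]. *)
Definition torus_coords : set ('I_k.+1 -> K) := [set c | E (spanc f c)].

Lemma spanc_unit c : e * spanc f c = spanc f c /\ spanc f c * e = spanc f c.
Proof.
rewrite /spanc mulr_sumr mulr_suml; split; apply: eq_bigr => i _.
  by rewrite -scalerAr (torus_unit i tf).1.
by rewrite -scalerAl (torus_unit i tf).2.
Qed.

Lemma torus_coords_zclosed v :
  (forall q : {mpoly K[k.+1]}, (forall c, torus_coords c -> q.@[c] = 0) -> q.@[v] = 0) ->
  torus_coords v.
Proof.
move=> hv; have [ev ve] := spanc_unit v; split=> //.
apply: clA => q qA; rewrite -linear_mpolys_eval; apply: hv => c [Ac _ _].
by rewrite linear_mpolys_eval; apply: qA.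
Qed.

Lemma torus_coords1 : torus_coords (fun=> 1).
Proof.
rewrite /torus_coords /= (_ : spanc _ _ = e); first exact: (lc1 lcE).
by rewrite -(torus_sum tf); apply: eq_bigr => i _; rewrite scale1r.
Qed.

Lemma torus_coordsD c d : torus_coords c -> torus_coords d -> torus_coords (fun i => c i + d i).
Proof. by rewrite /torus_coords /= -spancD => Ec Ed; apply: (lcD lcE). Qed.

Lemma torus_coordsM c d : torus_coords c -> torus_coords d -> torus_coords (fun i => c i * d i).
Proof. by rewrite /torus_coords /= -(spancM oi) => Ec Ed; apply: (lcM lcE). Qed.

Lemma torus_coordsX c l : torus_coords c -> torus_coords (fun i => c i ^+ l).
Proof.
move=> Ec; elim: l => [|l IH]; first exact: torus_coords1.
have -> : (fun i => c i ^+ l.+1) = (fun i => c i * c i ^+ l).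
  by apply/funext => i; rewrite exprS.
exact: torus_coordsM.
Qed.

Lemma torus_coordsB c d : torus_coords c -> torus_coords d -> torus_coords (fun i => c i - d i).
Proof.
move=> Ec Ed; rewrite /torus_coords /=.
suff -> : spanc f (fun i => c i - d i) = spanc f c - spanc f d by apply: (lcB lcE).
by rewrite /spanc -sumrB; apply: eq_bigr => i _; rewrite scalerBl.
Qed.

Lemma torus_coords_nil c i : nilpot (spanc f c) -> c i = 0.
Proof.
case=> l sl; have /(spanc_inj oi)/(_ i)/eqP : spanc f (fun i => c i ^+ l.+1) = spanc f (fun=> 0).
  by rewrite -(spancXS oi) exprSr sl mul0r spanc0.
by rewrite expf_eq0 => /eqP.
Qed.

(** A nonzero element of the torus is invertible in the corner [E]. *)
Lemma torus_coords_field c i : torus_coords c -> c i = 0 -> forall j, c j = 0.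
Proof.
move=> Ec ci; have [nc j|[y [_ cy _]]] := lc_nilVunit lcE Ec; first exact: torus_coords_nil.
have := oi_neq0 oi i; rewrite -(torus_unit i tf).2 -cy mulrA (spanc_mull oi) ci.
by rewrite scale0r mul0r eqxx.
Qed.

Lemma torus_offdiag c i j y : GRing.comm y (spanc f c) -> c i != c j -> f i * y * f j = 0.
Proof.
move=> yc cij; have : f i * (y * spanc f c) * f j = f i * (spanc f c * y) * f j by rewrite yc.
rewrite !mulrA -(mulrA (f i * y)) (spanc_mulr oi) (spanc_mull oi) -scalerAr -!scalerAl.
move/eqP; rewrite -subr_eq0 -scalerBl scaler_eq0 subr_eq0 eq_sym (negPf cij) => /eqP.
exact.
Qed.

Lemma torus_expand y : E y -> y = \sum_i \sum_j f i * y * f j.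
Proof.
move=> Ey; rewrite -{1}(lc_mul1l lcE Ey) -{1}(lc_mul1r lcE Ey) -(torus_sum tf).
rewrite mulr_suml; apply: eq_bigr => i _; rewrite mulrA mulr_sumr.
by apply: eq_bigr.
Qed.

Lemma torus_expand_eq0 y : E y -> (forall i j, f i * y * f j = 0) -> y = 0.
Proof.
by move=> Ey y0; rewrite (torus_expand Ey); apply: big1 => i _; apply: big1 => j _.
Qed.

Lemma torus_diag y : E y -> (forall i j, i != j -> f i * y * f j = 0) ->
  forall i, GRing.comm y (f i).
Proof.
move=> Ey yd; have yE : y = \sum_i f i * y * f i.
  rewrite {1}(torus_expand Ey); apply: eq_bigr => i _.
  by rewrite (bigD1 i) //= big1 ?addr0 // => j ji; apply: yd; rewrite eq_sym.
move=> i; rewrite /GRing.comm {1 2}yE mulr_suml mulr_sumr; apply: eq_bigr => j _.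
have [<-|ji] := eqVneq j i; first by rewrite !mulrA (oi_mul oi) -[LHS]mulrA (oi_mul oi).
by rewrite -[LHS]mulrA (oi_orth oi ji) mulr0 !mulrA (oi_orth oi) ?mul0r // eq_sym.
Qed.

(** In a strictly triangular matrix, heights increase along nonzero paths. *)
Lemma torus_height_nil (h : 'I_k.+1 -> nat) y : E y ->
  (forall i j, f i * y * f j != 0 -> (h i < h j)%N) -> nilpot y.
Proof.
move=> Ey hy; pose H := \max_i h i.
have EX l : E (y ^+ l.+1) by apply: (lcX lcE).
have step l i j : f i * y ^+ l.+1 * f j != 0 -> (h i + l < h j)%N.
  elim: l i => [|l IH] i; first by rewrite expr1 addn0; apply: hy.
  have sumE : f i * y ^+ l.+2 * f j = \sum_m (f i * y * f m) * (f m * y ^+ l.+1 * f j).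
    rewrite exprS -[in LHS](lc_mul1l lcE (EX l)) -(torus_sum tf) mulr_suml !mulr_sumr mulr_suml.
    by apply: eq_bigr => m _; rewrite -[in LHS](oi_mul oi m) !mulrA.
  apply: contraNT => hij; rewrite sumE; apply/eqP/big1 => m _.
  have [->|him] := eqVneq (f i * y * f m) 0; first by rewrite mul0r.
  have [->|hmj] := eqVneq (f m * y ^+ l.+1 * f j) 0; first by rewrite mulr0.
  by case/negP: hij; move: (hy _ _ him) (IH _ hmj); clear; lia.
exists H.+1; apply: torus_expand_eq0 (EX H) _ => i j; apply/eqP/negPn/negP => /step.
have : (h j <= H)%N by exact: leq_bigmax.
by clear; lia.
Qed.

(** By maximality, an element that commutes with the torus has its
    diagonalizable Frobenius powers in the torus. *)
Lemma torus_absorb y : E y -> (forall i, GRing.comm y (f i)) ->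
  exists u c, y ^+ (p ^ u) = spanc f c.
Proof.
move=> Ey yf; have [u [r [mu [mu_inj sM]]]] := frobenius_diagonalizable pK y.
have [eta [etaM eta1 sE eta_comm]] := spectral_idempotents mu_inj sM.
set s := y ^+ (p ^ u) in sM sE eta_comm.
have Es : E s by rewrite /s -(prednK (p0 u)); apply: (lcX lcE).
have fs i : GRing.comm (f i) s by apply/commrX/commr_sym.
have feta i j : GRing.comm (f i) (eta j) by apply: eta_comm.
pose good (x : 'I_k.+1 * 'I_r) := f x.1 * eta x.2 != 0.
pose J : finType := {x in good}.
pose g (x : J) : B := f (val x).1 * eta (val x).2.
have gM x y' : f x.1 * eta x.2 * (f y'.1 * eta y'.2)
    = (f x.1 * f y'.1) * (eta x.2 * eta y'.2).
  by rewrite !mulrA -(mulrA (f x.1)) -(feta y'.1 x.2) !mulrA.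
have sumJ (d : 'I_k.+1 -> 'I_r -> K) :
    spanc g (fun x => d (val x).1 (val x).2) = \sum_i \sum_j d i j *: (f i * eta j).
  rewrite pair_bigA /= (bigID good) /= [X in _ = _ + X]big1 ?addr0 => [|x].
    exact/esym/(big_sub good (fun x => d x.1 x.2 *: (f x.1 * eta x.2))).
  by rewrite negbK => /eqP ->; rewrite scaler0.
have spanf c : spanc f c = \sum_i \sum_j c i *: (f i * eta j).
  apply: eq_bigr => i _; rewrite -[f i in LHS]mulr1 -eta1 mulr_sumr scaler_sumr.
  by apply: eq_bigr.
have sfE : s = \sum_i \sum_j mu j *: (f i * eta j).
  rewrite -(lc_mul1l lcE Es) -(torus_sum tf) mulr_suml; apply: eq_bigr => i _.
  by rewrite [s in LHS]sE mulr_sumr; apply: eq_bigr => j _; rewrite -scalerAr.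
have tg : torus g.
  split.
  - split=> [x|x y' xy|x]; last exact: (valP x).
      by rewrite /g gM (oi_mul oi) etaM eqxx.
    rewrite /g gM (oi_mulE _ _ oi) etaM; case: eqP => [x1|]; last by rewrite mul0r.
    case: eqP => [x2|]; last by rewrite mulr0.
    by case/eqP: xy; apply: val_inj; apply/eqP; rewrite -pair_eqE /= x1 x2 !eqxx.
  - have <- : spanc f (fun=> 1) = e.
      by rewrite -(torus_sum tf); apply: eq_bigr => i _; rewrite scale1r.
    rewrite spanf -(sumJ (fun _ _ => 1)).
    by apply: eq_bigr => x _; rewrite scale1r.
  - move=> x y' xy; have [x1|x1] := eqVneq (val x).1 (val y').1.
      exists (fun x => mu (val x).2); rewrite (sumJ (fun _ j => mu j)) -sfE; split=> //.
      apply: contra xy => /eqP/mu_inj x2; apply/eqP/val_inj/eqP.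
      by rewrite -pair_eqE /= x1 x2 !eqxx.
    have [c [Ec cxy]] := torus_sep tf x1.
    by exists (fun x => c (val x).1); rewrite (sumJ (fun i _ => c i)) -spanf.
have ex i : exists j, good (i, j).
  have [/existsP //|/existsPn no] := boolP [exists j, good (i, j)].
  have /eqP := oi_neq0 oi i; case; rewrite -[f i]mulr1 -eta1 mulr_sumr.
  by apply: big1 => j _; apply/eqP; have := no j; rewrite negbK.
pose h i : J := exist good (i, xchoose (ex i)) (xchooseP (ex i)).
have h_inj : injective h by move=> i j /(congr1 (fun x => (val x).1)).
have h_onto x : x \in codom h.
  by apply: inj_card_onto h_inj _ x; rewrite card_ord; apply: fmax tg.
have one i j : j != xchoose (ex i) -> f i * eta j = 0.
  move=> ji; apply/eqP/negPn/negP => fij.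
  have /codomP[i' /(congr1 val) /= [ii' ji']] := h_onto (exist good (i, j) fij).
  by case/eqP: ji; rewrite ji' ii'.
exists u, (fun i => mu (xchoose (ex i))).
rewrite -/s sfE spanf; apply: eq_bigr => i _; apply: eq_bigr => j _.
by have [->//|/one ->] := eqVneq j (xchoose (ex i)); rewrite !scaler0.
Qed.

End Torus.

(** * Infinite tori *)

Lemma closed_prim_root (K : closedFieldType) Q : (0 < Q)%N -> Q%:R != 0 :> K ->
  exists z : K, Q.-primitive_root z.
Proof.
move=> Q0 QK; have [rs rsE] := closed_field_poly_normal ('X^Q - 1 : {poly K}).
have lc : lead_coef ('X^Q - 1 : {poly K}) = 1 by rewrite lead_coefXnsubC.
rewrite lc scale1r in rsE.
have Urs : uniq rs by rewrite -separable_prod_XsubC -rsE separable_Xn_sub_1.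
have sz : (Q <= size rs)%N.
  by rewrite -ltnS -(size_prod_XsubC rs id) -rsE size_XnsubC.
have rs1 : all Q.-unity_root rs.
  by apply/allP=> z zr; rewrite /root_of_unity rsE root_prod_XsubC.
have /hasP[z _ zP] := cyclic.has_prim_root Q0 rs1 Urs sz.
by exists z.
Qed.

Section TorusComplement.
Variables (K : closedFieldType) (B : falgType K) (p : nat).
Hypothesis pK : p \in [pchar K].
Variables (n : nat) (b : n.-tuple B) (A : set B) (e : B).
Hypothesis clA : zclosed b A.
Notation E := (corner A e).
Hypotheses (lcE : local_corner E e) (EV : forall k x, E x -> E ((k%:R^-1 : K) *: x)).
Variables (k : nat) (f : 'I_k.+1 -> B).
Hypotheses (tf : torus A e f)
  (fmax : forall (J : finType) (g : J -> B), torus A e g -> (#|J| <= k.+1)%N).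

Let oi := torus_oi tf.
Let pB := pchar_falg B pK.
Let p0 u : (0 < p ^ u)%N.
Proof. by rewrite expn_gt0 prime_gt0 ?(pcharf_prime pK). Qed.

Notation torus_coords := (torus_coords A e f).

Definition torus_mod_nil (y : B) := exists c, torus_coords c /\ nilpot (y - spanc f c).

Section Generator.
Variables (c0 : 'I_k.+1 -> K) (Q : nat).
Hypotheses (Pc0 : torus_coords c0) (Q0 : (0 < Q)%N) (QK : Q%:R != 0 :> K).
Hypotheses (c0Q : forall i, c0 i ^+ Q = 1)
  (c0_unit : forall l, (0 < l < Q)%N -> c0 ord0 ^+ l != 1)
  (c0_sep : forall i j, i != j -> c0 i != c0 j)
  (Pc_root : forall c u, torus_coords c -> exists d,
    torus_coords d /\ forall i, c i = d i ^+ (p ^ u)).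

Let w := spanc f c0.

Lemma gen_expX l : w ^+ l * e = spanc f (fun i => c0 i ^+ l).
Proof.
case: l => [|l].
  by rewrite mul1r -(torus_sum tf); apply: eq_bigr => i _; rewrite scale1r.
by rewrite (spancXS oi) (spanc_unit tf _).2.
Qed.

Lemma gen_in : E w. Proof. exact: Pc0. Qed.

Lemma gen_expQ : w ^+ Q = e.
Proof.
rewrite -(prednK Q0) (spancXS oi) prednK // -(torus_sum tf).
by apply: eq_bigr => i _; rewrite c0Q scale1r.
Qed.

Lemma gen_unit l : (0 < l < Q)%N -> ~ nilpot (w ^+ l - e).
Proof.
move=> lQ; have /andP[l0 _] := lQ.
have -> : w ^+ l - e = spanc f (fun i => c0 i ^+ l - 1).
  rewrite -(prednK l0) (spancXS oi) -(torus_sum tf) -sumrB; apply: eq_bigr => i _.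
  by rewrite prednK // scalerBl scale1r.
move/(torus_coords_nil tf ord0)/eqP; rewrite subr_eq0.
by apply/negP/c0_unit.
Qed.

(** Some Frobenius power of [y] is in the torus, and the same power of some
    torus element [d] is equal to it; as [y] and [d] commute, [y - d] is
    nilpotent. *)
Lemma gen_comm y : E y -> w * y = y * w -> torus_mod_nil y.
Proof.
move=> Ey wy; have yf : forall i, GRing.comm y (f i).
  apply: (torus_diag lcE tf Ey) => i j ij.
  by apply: (torus_offdiag tf (c := c0)); [exact/esym|apply: c0_sep].
have [u [c yc]] := torus_absorb pK lcE tf fmax Ey yf.
have Ec : torus_coords c by rewrite /torus_coords /= -yc -(prednK (p0 u)); apply: (lcX lcE).
have [d [Ed cd]] := Pc_root u Ec.
exists d; split=> //; exists (p ^ u)%N.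
rewrite (exprB_frobenius_comm pB) ?yc.
  rewrite -{1}(prednK (p0 u)) (spancXS oi) prednK // -(spanc0 f).
  rewrite /spanc -sumrB; apply: eq_bigr => i _.
  by rewrite -cd subrr scale0r.
rewrite /GRing.comm /spanc mulr_sumr mulr_suml; apply: eq_bigr => i _.
by rewrite -scalerAl -scalerAr (yf i).
Qed.

Lemma torus_mod_nil_sum I (r : seq I) (P : pred I) (y : I -> B) :
  (forall i, P i -> E (y i) /\ torus_mod_nil (y i)) ->
  torus_mod_nil (\sum_(i <- r | P i) y i).
Proof.
move=> Ey; suff [] : E (\sum_(i <- r | P i) y i) /\ torus_mod_nil (\sum_(i <- r | P i) y i) by [].
apply: (big_ind (fun x => E x /\ torus_mod_nil x)) => //.
  split; first exact: (lc0 lcE).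
  exists (fun=> 0); rewrite /torus_coords /= spanc0 subrr; split; first exact: (lc0 lcE).
  exact: nilpot0.
move=> x z [Ex [c [Pcc nc]]] [Ez [d [Pd nd]]]; split; first exact: (lcD lcE).
exists (fun i => c i + d i); split; first exact: (torus_coordsD lcE).
rewrite -spancD opprD addrACA; apply: (lc_nilD lcE) => //; exact: (lcB lcE).
Qed.

Lemma gen_complement :
  (forall c y, E y -> ~ nilpot y -> w ^+ c * y = y * w -> (c < Q)%N -> (c = 1 %[mod Q])%N) ->
  forall y, E y -> torus_mod_nil y.
Proof.
move=> H y Ey; rewrite (isotypic_sum lcE gen_in Q0 QK gen_expQ gen_unit Ey).
apply: torus_mod_nil_sum => c _.
have Ec := isotypic_in Q lcE EV gen_in c Ey; split=> //.
have cc := isotypic_comm lcE gen_in Q0 gen_expQ c Ey.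
have [nc|nc] := pselect (nilpot (isotypic w Q c y)).
  exists (fun=> 0); rewrite /torus_coords /= spanc0 subr0; split=> //; exact: (lc0 lcE).
apply: gen_comm => //; rewrite -cc -[RHS](expw_mod lcE gen_in gen_expQ) //.
by rewrite (H _ _ Ec nc cc) // (expw_mod lcE gen_in gen_expQ).
Qed.

End Generator.

(** For [c <> 1] modulo the order of the generator, the entries of [y] between
    the weights [a i] and [a j] vanish unless [a j - a i] is a constant, nonzero
    integer; then [y] is strictly triangular. *)
Lemma infinite_torus_complement : ~ finite_set torus_coords -> forall y, E y -> torus_mod_nil y.
Proof.
move=> Pinf.
have [a aP] := frobenius_curve pK (torus_coords_zclosed clA tf) (torus_coords1 lcE tf)
  (@torus_coordsD _ _ _ _ lcE _ f)
  (@torus_coordsM _ _ _ _ lcE _ _ tf) (@torus_coords_field _ _ _ _ lcE _ _ tf) Pinf.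
have a_inj i j : i != j -> a i != a j.
  move=> ij; have [c [Ec]] := torus_sep tf ij; apply: contra => /eqP aij.
  by have [t ct] := (aP c).1 Ec; rewrite !ct aij.
(* The order of the generator separates the sums of two weights. *)
pose M := (2 * \max_i a i).+2; pose Q := (p ^ M).-1.
have aM i j : (a i + a j < M.-1)%N.
  have h l : (a l <= \max_i a i)%N by apply: leq_bigmax.
  by have := h i; have := h j; rewrite /M /=; lia.
have p1 : (1 < p)%N := prime_gt1 (pcharf_prime pK).
have QE : (p ^ M = Q.+1)%N by rewrite /Q prednK.
have Q0 : (0 < Q)%N by rewrite -ltnS -QE -[1%N](exp1n M) ltn_exp2r.
have QK : Q%:R != 0 :> K.
  rewrite -(dvdn_pcharf pK); apply/negP => pQ.
  have : (p %| Q.+1)%N by rewrite -QE dvdn_exp.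
  by rewrite -addn1 dvdn_addr // dvdn1; move: p1; case: (p) => [|[]].
have pQ u : coprime (p ^ u) Q.
  apply: coprimeXl; rewrite prime_coprime ?(pcharf_prime pK) //.
  by rewrite (dvdn_pcharf pK).
have powQ u v : (u < M.-1)%N -> (v < M.-1)%N -> (p ^ u = p ^ v %[mod Q])%N -> u = v.
  have small l : (l < M.-1)%N -> (p ^ l < Q)%N.
    move=> lM; have lM' : (p ^ l.+2 <= Q.+1)%N by rewrite -QE leq_exp2l.
    have : (2 * (2 * p ^ l) <= p ^ l.+2)%N by rewrite !expnS !leq_mul.
    by have := p0 l; lia.
  by move=> /small uQ /small vQ; rewrite !modn_small // => /eqP; rewrite eqn_exp2l // => /eqP.
have [z zP] := closed_prim_root Q0 QK.
pose c0 i := z ^+ (p ^ a i).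
have Ec0 : torus_coords c0 by apply/aP; exists z.
have fw i l : f i * spanc f c0 ^+ l = c0 i ^+ l *: f i.
  elim: l => [|l IH]; first by rewrite mulr1 scale1r.
  by rewrite exprSr mulrA IH -scalerAl (spanc_mull oi) scalerA -exprSr.
apply: (@gen_complement c0 Q) => //.
- by move=> i; rewrite /c0 exprAC (prim_expr_order zP) expr1n.
- move=> l /andP[l0 lQ]; rewrite /c0 -exprM -(prim_order_dvd zP).
  by rewrite Gauss_dvdr 1?coprime_sym //; apply/negP=> /dvdn_leq; lia.
- move=> i j ij; rewrite /c0 (eq_prim_root_expr zP); apply: contra (a_inj i j ij).
  have := aM i i; have := aM j j => h1 h2.
  by move/eqP => /powQ h; apply/eqP/h; lia.
- move=> c u Ec; have [t ct] := (aP c).1 Ec.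
  have [s st] := exists_root t (p0 u).
  exists (fun i => s ^+ (p ^ a i)); split; first by apply/aP; exists s.
  by move=> i; rewrite ct -st exprAC.
move=> c y Ey ny wy cQ; apply: contra_notP ny => /eqP c1.
have pairE i j : f i * y * f j != 0 -> (p ^ a i * c = p ^ a j %[mod Q])%N.
  move=> fy; apply/eqP; rewrite -(eq_prim_root_expr zP) exprM -subr_eq0.
  have : f i * (spanc f c0 ^+ c * y) * f j = f i * (y * spanc f c0) * f j by rewrite wy.
  rewrite !mulrA fw -[f i * y * _ * _]mulrA (spanc_mulr oi) -scalerAr -!scalerAl => /eqP.
  by rewrite -subr_eq0 -scalerBl scaler_eq0 (negPf fy) orbF.
(* All nonzero entries of [y] shift the weights by the same amount. *)
have diffE i j i' j' : f i * y * f j != 0 -> f i' * y * f j' != 0 ->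
    (a j + a i' = a j' + a i)%N.
  move=> /pairE ij /pairE ij'; apply: powQ => //.
  rewrite !expnD -modnMml -ij modnMml -[in RHS]modnMml -ij' modnMml mulnAC.
  by rewrite [in RHS]mulnAC [X in (X * c)%N = _ %[mod _]]mulnC.
have [[i0 [j0 nz0]]|no] := pselect (exists i j, f i * y * f j != 0); last first.
  rewrite (torus_expand_eq0 lcE tf Ey); first exact: nilpot0.
  by move=> i j; apply/eqP/negPn/negP => nz; apply: no; exists i, j.
have [lt|lt|eq] := ltngtP (a i0) (a j0).
- apply: (torus_height_nil lcE tf (h := a)) => // i j nz.
  by have := diffE _ _ _ _ nz nz0; lia.
- apply: (torus_height_nil lcE tf (h := fun i => (\max_l a l - a i)%N)) => // i j nz.
  have h l : (a l <= \max_i a i)%N by apply: leq_bigmax.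
  by have := diffE _ _ _ _ nz nz0; have := h i; have := h j; lia.
case/negP: c1; have := pairE _ _ nz0; rewrite -eq => /eqP.
rewrite -(eq_prim_root_expr zP) exprM -[X in _ == X]expr1.
rewrite (eq_prim_root_expr (z := z ^+ (p ^ a i0)) (n := Q)) //.
by rewrite prim_root_exp_coprime.
Qed.

End TorusComplement.

(** * Finite tori *)

Section FiniteSubfield.
Variable K : closedFieldType.

(** Multiplication by a nonzero [x] permutes the nonzero elements, whence
    [x ^+ Q = 1]. *)
Lemma finite_subfield_root (L : seq K) : uniq L -> 0 \in L -> 1 \in L ->
  (forall x y, x \in L -> y \in L -> x * y \in L) ->
  exists Q z, [/\ (0 < Q)%N, size L = Q.+1, Q.-primitive_root z, z \in L
    & forall x, x \in L -> x = 0 \/ exists l, x = z ^+ l].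
Proof.
move=> UL L0 L1 LM; pose L' := rem 0 L; pose Q := size L'.
have memL' x : (x \in L') = (x != 0) && (x \in L) by rewrite mem_rem_uniq.
have UL' : uniq L' by apply: rem_uniq.
have sL : size L = Q.+1.
  by rewrite /Q size_rem // prednK //; case: (L) L0.
have Q0 : (0 < Q)%N.
  have : 1 \in L' by rewrite memL' oner_eq0.
  by rewrite /Q; case: (L').
have LQ x : x \in L' -> x ^+ Q = 1.
  rewrite memL' => /andP[x0 xL].
  have Ux : uniq (map ( *%R x) L') by rewrite map_inj_uniq //; apply: mulfI.
  have sub : {subset map ( *%R x) L' <= L'}.
    move=> _ /mapP[y + ->]; rewrite !memL' => /andP[y0 yL].
    by rewrite mulf_neq0 // LM.
  have [|_ eqL] := uniq_min_size Ux sub; first by rewrite size_map.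
  have pe : perm_eq (map ( *%R x) L') L' by apply: uniq_perm.
  have nz : \prod_(y <- L') y != 0.
    by rewrite prodf_seq_neq0; apply/allP => y; rewrite memL' => /andP[].
  apply: (mulIf nz); rewrite mul1r -[RHS](perm_big _ pe) big_map big_split /=.
  by rewrite big_const_seq count_predT iter_mulr_1.
have rs1 : all Q.-unity_root L'.
  by apply/allP=> x xL; rewrite unity_rootE LQ.
have /hasP[z zL zP] := cyclic.has_prim_root Q0 rs1 UL' (leqnn _).
exists Q, z; split=> //; first by move: zL; rewrite memL' => /andP[].
move=> x xL; have [->|x0] := eqVneq x 0; first by left.
right; have xL' : x \in L' by rewrite memL' x0.
by have [l ->] := prim_rootP zP (LQ _ xL'); exists l.
Qed.

(** The polynomial [(X + 1)^a - X^a - 1] has degree less than [a], so it is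
    determined by its values on [L]. *)
Lemma additive_exponent_on p (pK : p \in [pchar K]) (L : seq K) a :
  uniq L -> (0 < a <= size L)%N -> (forall t, t \in L -> (t + 1) ^+ a = t ^+ a + 1) ->
  exists u, a = (p ^ u)%N.
Proof.
move=> UL /andP[a0 aL] aD; apply: (additive_exponent pK a0).
pose q : {poly K} := ('X + 1%:P) ^+ a - 'X^a - 1%:P.
have sz : size (('X + 1%:P : {poly K}) ^+ a) = a.+1.
  by rewrite -[1%:P]opprK -polyCN size_exp_XsubC.
suff q0 : q = 0.
  move=> t; have : q.[t] = 0 by rewrite q0 horner0.
  by rewrite !hornerE => /eqP; rewrite subr_eq0 subr_eq [1 + _]addrC => /eqP.
apply: roots_geq_poly_eq0 UL _.
  by apply/allP=> t tL; rewrite rootE !hornerE aD // addrAC addrK subrr.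
apply: leq_trans aL; apply/leq_sizeP => j aj.
rewrite !coefB coefXn coefC [j == 0%N]eqn0Ngt (leq_trans a0 aj) subr0.
have [->|ja] := eqVneq j a.
  have : ('X + 1%:P : {poly K}) ^+ a \is monic by rewrite monic_exp // monicXaddC.
  by rewrite monicE lead_coefE sz /= => /eqP ->; rewrite subrr.
rewrite subr0 nth_default // sz ltn_neqAle eq_sym ja //.
Qed.

End FiniteSubfield.

Section FiniteTorus.
Variables (K : closedFieldType) (B : falgType K) (p : nat).
Hypothesis pK : p \in [pchar K].
Variables (A : set B) (e : B).
Notation E := (corner A e).
Hypotheses (lcE : local_corner E e) (EV : forall k x, E x -> E ((k%:R^-1 : K) *: x)).
Variables (k : nat) (f : 'I_k.+1 -> B).
Hypotheses (tf : torus A e f)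
  (fmax : forall (J : finType) (g : J -> B), torus A e g -> (#|J| <= k.+1)%N).

Let oi := torus_oi tf.
Notation torus_coords := (torus_coords A e f).

(** An invertible [y] with [w ^+ c * y = y * w] conjugates the torus by
    [x |-> x ^+ c], an automorphism, so [c] is a power of [p].  For the least
    such power [r = p ^ g] with [g > 0], [g] divides [M], where [p ^ M] is the
    number of elements of the torus; let [u = M / g].  If [u > 1] and [x] is
    such an invertible element for [r], then [x ^+ u] is, up to a nilpotent, an
    element [w ^+ s'] of the torus fixed by the automorphism.  It is a norm, so
    some multiple [zz] of [x] has [zz ^+ u = e] up to a nilpotent.  Then
    [zz - e] or [\sum_(l < u) zz ^+ l] is nilpotent, and so is its component
    in the centralizer of [w], which is [- e] or [e]. *)
Lemma finite_torus_complement : finite_set torus_coords ->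
  forall y, E y -> torus_mod_nil A e f y.
Proof.
move=> Pfin.
have [s sE] := (finite_seqP _).1 (finite_image (fun c : 'I_k.+1 -> K => c ord0) Pfin).
pose L := undup s.
have memL t : t \in L <-> exists2 c, torus_coords c & c ord0 = t.
  have -> : (t \in L) = (t \in s) by rewrite mem_undup.
  by have /(congr1 (fun S : set K => S t)) /= := sE => <-.
have c_inj c d : torus_coords c -> torus_coords d -> c ord0 = d ord0 -> c = d.
  move=> Ec Ed cd; apply/funext => i; apply/eqP; rewrite -subr_eq0; apply/eqP.
  apply: (torus_coords_field lcE tf (c := fun i => c i - d i) (i := ord0)).
    exact: (torus_coordsB lcE).
  by rewrite cd subrr.
have [||||Q [z [Q0 sL zP zL Lz]]] := @finite_subfield_root K L.
- exact: undup_uniq.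
- apply/memL; exists (fun=> 0) => //; rewrite /torus_coords /= spanc0; exact: (lc0 lcE).
- by apply/memL; exists (fun=> 1) => //; apply: (torus_coords1 lcE).
- move=> x y /memL[c Ec <-] /memL[d Ed <-]; apply/memL.
  by exists (fun i => c i * d i) => //; apply: (torus_coordsM lcE).
have /memL[c0 Ec0 c0z] := zL.
have Pc_pow c : torus_coords c -> c = (fun=> 0) \/ exists l, c = fun i => c0 i ^+ l.
  move=> Ec; have [|c00|[l cl]] := Lz (c ord0); first by apply/memL; exists c.
    by left; apply: c_inj => //; rewrite /torus_coords /= spanc0; exact: (lc0 lcE).
  by right; exists l; apply: c_inj => //; [exact: (torus_coordsX lcE)|rewrite cl c0z].
have c0Q i : c0 i ^+ Q = 1.
  have : (fun i => c0 i ^+ Q) = fun=> 1.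
    apply: c_inj; [exact: (torus_coordsX lcE)|exact: (torus_coords1 lcE)|].
    by rewrite c0z (prim_expr_order zP).
  by move/(congr1 (fun c => c i)).
have LQ t : t \in L -> t ^+ Q.+1 = t.
  case/Lz => [->|[l ->]]; first by rewrite expr0n.
  by rewrite exprS exprAC (prim_expr_order zP) expr1n mulr1.
have UL : uniq L by apply: undup_uniq.
have LD1 t : t \in L -> t + 1 \in L.
  move=> /memL[c Ec <-]; apply/memL; exists (fun i => c i + 1) => //.
  by apply: (torus_coordsD lcE) => //; apply: (torus_coords1 lcE).
have [M QM] : exists M, Q.+1 = (p ^ M)%N.
  apply: (additive_exponent_on pK UL); first by rewrite sL leqnn.
  by move=> t tL; rewrite !LQ // LD1.
have M0 : (0 < M)%N by case: (M) QM Q0 => // -[->].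
have QK : Q%:R != 0 :> K := prim_root_natf_neq0 zP.
have c0_unit l : (0 < l < Q)%N -> c0 ord0 ^+ l != 1.
  move=> /andP[l0 lQ]; rewrite c0z -(prim_order_dvd zP).
  by apply/negP=> /dvdn_leq; lia.
have c0_sep i j : i != j -> c0 i != c0 j.
  move=> ij; have [c [/Pc_pow[->|[l ->]]]] := torus_sep tf ij; first by rewrite eqxx.
  by apply: contra => /eqP ->.
have c0q i : c0 i ^+ (p ^ M) = c0 i by rewrite -QM exprS c0Q mulr1.
have Pc_root c u : torus_coords c -> exists d, torus_coords d /\ forall i, c i = d i ^+ (p ^ u).
  move=> Ec; exists (fun i => c i ^+ (p ^ (M.-1 * u))); split; first exact: (torus_coordsX lcE).
  have cq i : c i ^+ (p ^ M) = c i.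
    have [->|[l ->]] := Pc_pow c Ec; last by rewrite exprAC c0q.
    by rewrite -QM expr0n.
  move=> i; rewrite -exprM -expnD -[X in (_ + X)%N]mul1n -mulnDl addn1 prednK //.
  by rewrite expnM; elim: u => [|u IH]; rewrite ?expr1 // expnS exprM cq.
apply: (gen_complement pK lcE EV tf fmax Ec0 Q0 QK c0Q c0_unit c0_sep Pc_root).
set w := spanc f c0.
have Ew : E w := Ec0.
have wQ : w ^+ Q = e := gen_expQ tf Q0 c0Q.
have w_unit := gen_unit tf c0_unit.
pose deg (y : B) c := w ^+ c * y = y * w.
have degX c y l : deg y c -> y * w ^+ l = w ^+ (c * l) * y.
  move=> cy; elim: l => [|l IH]; first by rewrite muln0 mul1r mulr1.
  by rewrite exprSr mulrA IH -mulrA -cy mulrA -exprD mulnS addnC.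
have degM x y c d : deg x c -> deg y d -> deg (x * y) (c * d)%N.
  by move=> cx dy; rewrite /deg mulrA -(degX _ _ _ cx) -!mulrA dy.
have degXn y c l : deg y c -> deg (y ^+ l) (c ^ l)%N.
  move=> cy; elim: l => [|l IH]; first by rewrite /deg mul1r mulr1.
  by rewrite exprS expnS; apply: degM.
have ee : e * e = e by apply: (lc_mul1l lcE); apply: (lc1 lcE).
have Ee : E e := lc1 lcE.
have inv y : E y -> ~ nilpot y -> exists y', [/\ E y', y * y' = e & y' * y = e].
  by move=> Ey ny; have [/ny|] := lc_nilVunit lcE Ey.
have powE l : spanc f (fun i => c0 i ^+ l) = w ^+ l * e by rewrite (gen_expX tf).
have EXe l : E (w ^+ l * e) by apply: (lcXM lcE).
have expX1 y : E y -> w ^+ Q.+1 * y = w * y.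
  by move=> Ey; rewrite exprS -mulrA wQ (lc_mul1l lcE).
have deg_power y c : E y -> ~ nilpot y -> deg y c -> (0 < c <= Q)%N ->
    exists v, c = (p ^ v)%N.
  move=> Ey ny cy /andP[cgt0 cQ].
  (* Conjugation by [y] raises the elements of the torus to the power [c]. *)
  have twist d : torus_coords d -> spanc f (fun i => d i ^+ c) * y = y * spanc f d.
    case/Pc_pow => [->|[l ->]].
      have -> : (fun i : 'I_k.+1 => (0 : K) ^+ c) = fun=> 0.
        by apply/funext => i; rewrite expr0n eqn0Ngt cgt0.
      by rewrite spanc0 mulr0 mul0r.
    have -> : (fun i => (c0 i ^+ l) ^+ c) = fun i => c0 i ^+ (c * l).
      by apply/funext => i; rewrite -exprM mulnC.
    rewrite !powE mulrA (degX c) // -!mulrA (lc_mul1l lcE Ey).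
    by rewrite (lc_mul1r lcE Ey).
  have [y' [Ey' yy' _]] := inv y Ey ny.
  have cancel u v : spanc f u * y = spanc f v * y -> u =1 v.
    move/(congr1 (fun x => x * y')); rewrite -!mulrA yy'.
    by rewrite !(spanc_unit tf _).2; apply: (spanc_inj oi).
  apply: (additive_exponent_on pK UL); first by rewrite cgt0 sL ltnW.
  move=> t /memL[d Pd <-].
  apply: (cancel (fun i => (d i + 1) ^+ c) (fun i => d i ^+ c + 1)).
  have span1 : spanc f (fun=> 1) = e.
    by rewrite -(torus_sum tf); apply: eq_bigr => i _; rewrite scale1r.
  rewrite twist; last by apply: (torus_coordsD lcE) => //; apply: (torus_coords1 lcE).
  rewrite -!spancD span1 mulrDr mulrDl twist // (lc_mul1r lcE Ey).
  by rewrite (lc_mul1l lcE Ey).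
have pow_neq1 l : (0 < l < M)%N -> (p ^ l != 1 %[mod Q])%N.
  move=> /andP[l0 lM]; have p1 : (1 < p)%N := prime_gt1 (pcharf_prime pK).
  have : (p ^ l < Q.+1)%N by rewrite QM ltn_exp2l.
  have : (1 < p ^ l)%N by rewrite -[1%N](expn0 p) ltn_exp2l.
  move=> h1 h2; rewrite eqn_mod_dvd; last exact: ltnW.
  by apply/negP => /dvdn_leq; rewrite subn_gt0 h1; move: h1 h2; clear; lia.
move=> c y Ey ny cy cQ; have [//|c1] := eqVneq (c %% Q)%N (1 %% Q)%N.
pose G l := `[< (0 < l)%N /\ exists y, [/\ E y, ~ nilpot y & deg y (p ^ l)%N] >].
have [v vM Gv] : exists2 v, (v < M)%N & G v.
  (* The exponent [c = 0] is replaced by [Q], which acts in the same way. *)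
  pose c' := if c == 0%N then Q else c.
  have c'Q : (0 < c' <= Q)%N by rewrite /c'; case: eqP => [_|/eqP]; lia.
  have cy' : deg y c'.
    rewrite /deg -cy /c'; case: eqP => // ->.
    by rewrite wQ mul1r (lc_mul1l lcE).
  have [v vE] := deg_power y c' Ey ny cy' c'Q; exists v.
    have p1 : (1 < p)%N := prime_gt1 (pcharf_prime pK).
    by rewrite -(ltn_exp2l _ _ p1) -vE -QM ltnS; case/andP: c'Q.
  apply/asboolP; split; last by exists y; rewrite -vE.
  case: v vE => // c'1; case/eqP: c1; move: c'1; rewrite /c'.
  by case: eqP => [-> -> |_ ->]; rewrite ?modn1 ?expn0 ?modn1.
have exG : exists l, G l by exists v.
have [g /asboolP[g0 [x [Ex nx rx]]] gmin] := ex_minnP exG.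
have gM : (g < M)%N by apply: leq_ltn_trans vM; apply: gmin.
set r := (p ^ g)%N in rx.
have [x' [Ex' xx' x'x]] := inv x Ex nx.
have EX l : E (x ^+ l.+1) by apply: (lcX lcE).
have EX' l : E (x' ^+ l.+1) by apply: (lcX lcE).
have xxX l : x ^+ l.+1 * x' ^+ l.+1 = e /\ x' ^+ l.+1 * x ^+ l.+1 = e.
  have eX m : e ^+ m.+1 = e by elim: m => [|m IH]; rewrite ?expr1 // exprS IH.
  have cxx : GRing.comm x x' by rewrite /GRing.comm xx' x'x.
  by split; rewrite -exprMn_comm ?xx' ?x'x ?eX //; apply: commr_sym.
have u0 : (0 < M %/ g)%N by rewrite divn_gt0 // ltnW.
set u := (M %/ g)%N in u0.
(* Otherwise a power of the inverse of [x] realizes the remainder of [M]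
   modulo [g]. *)
have gu : (M = u * g)%N.
  have [|m0] := posnP (M %% g); first by move=> m0; rewrite {1}(divn_eq M g) m0 addn0.
  suff /gmin : G (M %% g)%N by rewrite leqNgt ltn_pmod.
  apply/asboolP; split=> //; exists (x' ^+ u); rewrite -(prednK u0); split=> //.
    move=> nX'; have [_ x'xX] := xxX u.-1.
    exact: (lc_nil_not_unit lcE (EX' _) (EX _) nX' x'xX).
  rewrite /deg prednK //; have dX : deg (x ^+ u) (r ^ u)%N by apply: degXn.
  have [xX x'X] := xxX u.-1; rewrite prednK // in xX x'X.
  have EXu : E (x ^+ u) by rewrite -(prednK u0).
  have EXu' : E (x' ^+ u) by rewrite -(prednK u0).
  set l := (p ^ (M %% g))%N.
  rewrite -(lc_mul1l lcE (lcXM lcE l Ew EXu')) -x'X -mulrA [x ^+ u * _]mulrA.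
  rewrite (degX _ _ _ dX) -mulrA xX /r /l -expnM -expnD mulnC -divn_eq -QM.
  by rewrite expX1 // (lc_mul1r lcE Ew).
have u1 : (1 < u)%N by move: gM; rewrite gu -{1}[g]mul1n ltn_pmul2r.
have ruQ : (r ^ u = Q.+1)%N by rewrite QM gu /r -expnM mulnC.
pose Y := x ^+ u.
have EY : E Y by rewrite /Y -(prednK u0).
have wY : w * Y = Y * w by rewrite -expX1 // -ruQ; apply: degXn.
have [d [Pd nd]] := gen_comm pK lcE tf fmax c0_sep Pc_root EY wY.
have nY : ~ nilpot Y.
  move=> nY; have [xX _] := xxX u.-1; rewrite prednK // in xX.
  by apply: (lc_nil_not_unit lcE EY _ nY xX); rewrite -(prednK u0).
have [d0|[s' dE]] := Pc_pow d Pd; first by case: nY; move: nd; rewrite d0 spanc0 subr0.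
pose X := w ^+ s' * e.
have XE : spanc f d = X by rewrite dE powE.
rewrite XE in nd.
have nYX : nilpot (Y - X) := nd.
have EYX : E (Y - X) by apply: (lcB lcE EY (EXe s')).
(* [x] commutes with [Y], so its automorphism fixes the torus part of [Y]. *)
have s'r : (s' * r = s' %[mod Q])%N.
  have : nilpot ((w ^+ (s' * r) * e - X) * x).
    have -> : (w ^+ (s' * r) * e - X) * x = (Y - X) * x - x * (Y - X).
      have -> : (Y - X) * x - x * (Y - X) = x * X - X * x.
        rewrite mulrBl mulrBr (_ : x * Y = Y * x) ?opprB; last first.
          by rewrite /Y -exprS -exprSr.
        by rewrite addrC addrA subrK.
      rewrite mulrBl; congr (_ - _).
      rewrite /X mulrA (degX _ _ _ rx) -!mulrA (lc_mul1l lcE Ex).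
      by rewrite (lc_mul1r lcE Ex) mulnC.
    apply: (lc_nilB lcE); [exact: (lcM lcE)|exact: (lcM lcE)| |].
      exact: (lc_nilMr lcE).
    exact: (lc_nilMl lcE).
  case/(lc_nil_prime lcE (lcB lcE (EXe _) (EXe _)) Ex) => // nXX.
  have : c0 ord0 ^+ (s' * r) - c0 ord0 ^+ s' = 0.
    apply: (torus_coords_nil tf (c := fun i => c0 i ^+ (s' * r) - c0 i ^+ s')).
    suff -> : spanc f (fun i => c0 i ^+ (s' * r) - c0 i ^+ s')
           = w ^+ (s' * r) * e - X by [].
    by rewrite /X -!powE /spanc -sumrB; apply: eq_bigr => i _; rewrite scalerBl.
  move/eqP; rewrite subr_eq0 c0z (eq_prim_root_expr zP) => /eqP //.
have r1 : (1 < r)%N.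
  by rewrite -[1%N](expn0 p) ltn_exp2l // prime_gt1 ?(pcharf_prime pK).
pose sig l := (\sum_(i < l) r ^ i)%N.
(* Surjectivity of the norm [w ^+ t |-> w ^+ (t * sig u)] on fixed elements:
   [Q = (r - 1) * sig u] divides [s' * (r - 1)]. *)
have [t tE] : exists t, (s' = t * sig u)%N.
  apply/dvdnP; have QE : Q = (r.-1 * sig u)%N by rewrite -predn_exp ruQ.
  have : (Q %| s' * r - s')%N by rewrite -eqn_mod_dvd ?s'r // leq_pmulr // ltnW.
  rewrite -[X in (_ - X)%N]muln1 -mulnBr subn1 QE mulnC dvdn_pmul2r //.
  by move: r1; clear; lia.
(* [w ^+ Q.-1] is the inverse of [w]. *)
pose zz := w ^+ (Q.-1 * t) * x.
have Ezz : E zz by apply: (lcXM lcE).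
have dzz : deg zz r.
  rewrite /deg /zz mulrA -exprD addnC exprD -mulrA rx mulrA //.
have zzX l : zz ^+ l = w ^+ (Q.-1 * t * sig l) * x ^+ l.
  elim: l => [|l IH]; first by rewrite /sig big_ord0 muln0 mul1r.
  rewrite exprSr IH /zz mulrA -[_ * x ^+ l * _]mulrA (degX (r ^ l)%N); last exact: degXn.
  by rewrite !mulrA -exprD -mulrA -exprSr /sig big_ord_recr /= mulnDr [(r ^ l * _)%N]mulnC.
have nzz : nilpot (zz ^+ u - e).
  have eE : e = w ^+ (Q.-1 * t * sig u) * X.
    rewrite /X mulrA -exprD tE -mulnA -mulSnr prednK //.
    by rewrite -(expw_mod lcE Ew wQ _ Ee) modnMr mul1r.
  rewrite {1}eE zzX -mulrBr.
  by rewrite -[Y - X](lc_mul1l lcE EYX) mulrA; apply: (lc_nilMl lcE).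
pose S := \sum_(l < u) zz ^+ l * e.
have ES : E S by apply: (lc_sum lcE) => l _; apply: (lcXM lcE).
have Ezze : E (zz - e) by apply: (lcB lcE).
have zzS : (zz - e) * S = zz ^+ u - e.
  rewrite mulrBl (lc_mul1l lcE ES) -[X in _ - X = _]mul1r -mulrBl /S -mulr_suml mulrA.
  rewrite -subrX1 mulrBl mul1r (lc_mul1r lcE) //.
  by rewrite -(prednK u0); apply: (lcX lcE).
pose pi := proj1w w Q.
have pi_eq0 a y0 : E y0 -> deg y0 a -> (a != 1 %[mod Q])%N -> pi y0 = 0.
  by move=> Ey0 dy0 a1; apply: (proj1w_eq0 lcE Ew Q0 wQ w_unit Ey0 dy0).
have pi_e : pi e = e.
  by apply: (proj1w_id lcE Ew Q0 QK wQ Ee); rewrite (lc_mul1l lcE) ?(lc_mul1r lcE).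
have ne : ~ nilpot e := lc1_not_nil lcE.
have /(lc_nil_prime lcE Ezze ES) [nzze|nS] : nilpot ((zz - e) * S) by rewrite zzS.
  case: ne; rewrite -[e]opprK; apply: nilpotN.
  have := proj1w_nil Q lcE Ew Ezze nzze.
  rewrite proj1wD -/pi (pi_eq0 r) ?pow_neq1 ?g0 ?gM // add0r.
  rewrite /pi (proj1w_id lcE Ew Q0 QK wQ) //; first exact: (lcN lcE).
  by rewrite mulrN mulNr (lc_mul1l lcE) ?(lc_mul1r lcE).
case: ne; have := proj1w_nil Q lcE Ew ES nS.
suff -> : proj1w w Q S = e by [].
rewrite /S -(prednK u0) big_ord_recl mul1r proj1wD -/pi pi_e.
have pi0 : pi 0 = 0 by apply: (pi_eq0 r); rewrite ?pow_neq1 ?g0 ?gM //;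
  [exact: (lc0 lcE)|rewrite /deg mulr0 mul0r].
rewrite (big_morph pi (@proj1wD _ _ w Q) pi0) big1 ?addr0 // => l _.
apply: (pi_eq0 (r ^ l.+1)%N).
- by apply: (lcXM lcE).
- rewrite /deg -[zz ^+ _]/(zz ^+ l.+1) (lc_mul1r lcE) ?degXn //; exact: (lcX lcE).
rewrite /r -expnM; apply: pow_neq1; rewrite muln_gt0 g0 /= gu mulnC ltn_pmul2r //.
by rewrite -[X in (_ < X)%N](prednK u0) ltnS ltn_ord.
Qed.

End FiniteTorus.

(** * Splitting of a local corner *)

Section LocalSplitting.
Variables (F : fieldType) (K : closedFieldType) (phi : {rmorphism F -> K}).
Variables (B : falgType K) (n : nat) (b : n.-tuple B) (A : set B).
Hypotheses (hb : basis_of fullv b) (clA : zclosed b A) (hA : subalgebra phi A).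

(** A polynomial that vanishes at the natural multiples of [v] restricts to the
    line of [v] with infinitely many zeros. *)
Lemma pchar0_zclosed_scale : [pchar K] =i pred0 -> forall t v, A v -> A (t *: v).
Proof.
move=> /pcharf0P K0 t v Av; apply: clA => q qA.
pose r : {poly K} :=
  \sum_(m <- msupp q) q@_m *: \prod_(i < n) (coord b i v *: 'X) ^+ m i.
have rE s : r.[s] = q.@[fun i => coord b i (s *: v)].
  rewrite mevalE horner_sum; apply: eq_bigr => m _.
  rewrite hornerZ horner_prod; congr (_ * _); apply: eq_bigr => i _.
  by rewrite horner_exp hornerZ hornerX linearZ /= mulrC.
rewrite -rE; suff -> : r = 0 by rewrite horner0.
have [[_ AD AZ] _] := hA.
apply: (@roots_geq_poly_eq0 _ _ [seq i%:R | i <- iota 0 (size r)]).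
- apply/allP=> _ /mapP[i _ ->]; rewrite rootE rE; apply/eqP/qA.
  by rewrite -(rmorph_nat phi); apply: AZ.
- rewrite map_inj_in_uniq ?iota_uniq // => i j _ _ /= ij.
  wlog le_ij : i j ij / (i <= j)%N.
    by move=> H; case/orP: (leq_total i j) => h; [|symmetry]; apply: H.
  by apply/eqP; rewrite eqn_leq le_ij -subn_eq0 -K0 natrB // ij subrr eqxx.
by rewrite size_map size_iota.
Qed.

Variable e : B.
Notation E := (corner A e).
Hypothesis lcE : local_corner E e.

Lemma corner_scale a x : E x -> E (phi a *: x).
Proof.
have [[_ _ AZ] _] := hA.
by case=> Ax ex xe; split; rewrite -?scalerAr -?scalerAl ?ex ?xe //; apply: AZ.
Qed.

(** An annihilating polynomial of [x] splits, and its factors cannot all be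
    invertible. *)
Lemma local_eigenvalue x : E x -> (forall t y, E y -> E (t *: y)) ->
  exists t : K, nilpot (x - t *: e).
Proof.
move=> Ex EZ; have Ee := lc1 lcE.
have [q q0 qx] := annihilating_poly x.
have [rs qE] := closed_field_poly_normal q.
have px : horner_alg x (\prod_(z <- rs) ('X - z%:P)) * e = 0.
  move/eqP: qx; rewrite qE linearZ /= mulr_algl scaler_eq0 lead_coef_eq0 (negPf q0).
  by move/eqP => ->; rewrite mul0r.
apply: contrapT => no.
suff : forall l, E (horner_alg x (\prod_(z <- l) ('X - z%:P)) * e)
    /\ ~ nilpot (horner_alg x (\prod_(z <- l) ('X - z%:P)) * e).
  by case/(_ rs) => _; apply; rewrite px; apply: nilpot0.
elim=> [|z l [El nl]].
  by rewrite big_nil rmorph1 mul1r; split=> //; apply: lc1_not_nil lcE.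
rewrite big_cons rmorphM rmorphB /= horner_algX horner_algC -mulrA.
set y := _ * e in El nl *.
have -> : (x - z%:A) * y = (x - z *: e) * y.
  by rewrite !mulrBl mulr_algl -scalerAl (lc_mul1l lcE El).
have Exz : E (x - z *: e) by apply: (lcB lcE) => //; apply: EZ.
split; first exact: (lcM lcE).
by case/(lc_nil_prime lcE Exz El) => // nxz; apply: no; exists z.
Qed.

Lemma local_splitting : exists D : set B,
  [/\ subspace phi D, forall x y, D x -> D y -> D (x * y), D `<=` E,
    forall x, D x -> nilpot x -> x = 0
    & forall x, E x -> exists d, D d /\ nilpot (x - d)].
Proof.
have [[p pK]|noK] := pselect (exists p, p \in [pchar K]); last first.
  have K0 : [pchar K] =i pred0.
    by move=> p; apply/negP => pK; apply: noK; exists p.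
  have EZ t x : E x -> E (t *: x).
    case=> Ax ex xe; split; rewrite -?scalerAr -?scalerAl ?ex ?xe //.
    exact: pchar0_zclosed_scale.
  have Ee := lc1 lcE; have ee := lc_mul1l lcE Ee.
  exists [set x | exists t, x = t *: e]; split.
  - split.
    + by exists 0; rewrite scale0r.
    + by move=> _ _ [t ->] [s ->]; exists (t + s); rewrite scalerDl.
    + by move=> a _ [t ->]; exists (phi a * t); rewrite scalerA.
  - move=> _ _ [t ->] [s ->]; exists (t * s).
    by rewrite -scalerAl -scalerAr ee scalerA.
  - by move=> _ [t ->]; apply: EZ.
  - move=> _ [t ->] nte; have [->|t0] := eqVneq t 0; first by rewrite scale0r.
    case: (lc1_not_nil lcE); rewrite -[e]scale1r -(mulVf t0) -scalerA.
    exact: nilpot_scale.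
  move=> x Ex; have [t nt] := local_eigenvalue Ex EZ.
  by exists (t *: e); split=> //; exists t.
have EV k x : E x -> E ((k%:R^-1 : K) *: x).
  by rewrite -(rmorph_nat phi) -fmorphV; apply: corner_scale.
have [k [f [tf fmax]]] := torus_max lcE.
have oi := torus_oi tf.
exists [set x | exists2 c, torus_coords A e f c & x = spanc f c]; split.
- split.
  + by exists (fun=> 0); rewrite ?spanc0 // /torus_coords /= spanc0; apply: (lc0 lcE).
  + move=> _ _ [c Ec ->] [d Ed ->]; exists (fun i => c i + d i); first exact: (torus_coordsD lcE).
    by rewrite spancD.
  + move=> a _ [c Ec ->]; exists (fun i => phi a * c i); last by rewrite spancZ.
    by rewrite /torus_coords /= -spancZ; apply: corner_scale.
- move=> _ _ [c Ec ->] [d Ed ->]; exists (fun i => c i * d i); first exact: (torus_coordsM lcE).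
  by rewrite (spancM oi).
- by move=> _ [c Ec ->].
- move=> _ [c Ec ->] nc; rewrite -(spanc0 f); apply: eq_bigr => i _.
  by rewrite (torus_coords_nil tf i nc).
move=> x Ex; suff [c [Ec nc]] : torus_mod_nil A e f x.
  by exists (spanc f c); split=> //; exists c.
have [Pfin|Pinf] := pselect (finite_set (torus_coords A e f)).
  exact: (finite_torus_complement pK lcE EV tf fmax Pfin).
exact: (infinite_torus_complement pK clA lcE EV tf fmax Pinf).
Qed.

End LocalSplitting.

(** * Peirce decomposition and matrix units *)

Section Gluing.
Variables (F : fieldType) (K : closedFieldType) (phi : {rmorphism F -> K}).
Variables (B : falgType K) (n : nat) (b : n.-tuple B) (A : set B).
Hypotheses (hb : basis_of fullv b) (clA : zclosed b A) (hA : subalgebra phi A).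

Let A0 : A 0. Proof. by case: hA => [[]]. Qed.
Let AD x y : A x -> A y -> A (x + y). Proof. by case: hA => [[_ h _] _]; apply: h. Qed.
Let AM x y : A x -> A y -> A (x * y). Proof. by case: hA => [_ h]; apply: h. Qed.
Let AN x : A x -> A (- x). Proof. by case: hA => [h _]; apply: subspaceN h. Qed.
Let AZ a x : A x -> A (phi a *: x). Proof. by case: hA => [[_ _ h] _]; apply: h. Qed.
Let AB x y : A x -> A y -> A (x - y). Proof. by move=> Ax /AN; apply: AD. Qed.
Let A_sum I (r : seq I) (P : pred I) (g : I -> B) :
  (forall i, P i -> A (g i)) -> A (\sum_(i <- r | P i) g i).
Proof. by move=> Ag; apply: (big_ind A). Qed.

Let fit x : A x -> exists N g y,
  [/\ A g, A y, g * g = g, x * y = g /\ y * x = g & g * x ^+ N = x ^+ N].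
Proof. exact: (zclosed_idempotent hb clA AM). Qed.

Variables (I : finType) (f : I -> B).
Hypotheses (oi : orth_idem f) (Af : forall i, A (f i)).
Hypothesis fmax : forall (J : finType) (g : J -> B),
  orth_idem g -> (forall j, A (g j)) -> (#|J| <= #|I|)%N.

Lemma orth_idem_maximal_eq0 (h : I -> B) g : orth_idem h -> (forall i, A (h i)) -> A g ->
  g * g = g -> (forall i, h i * g = 0 /\ g * h i = 0) -> g = 0.
Proof.
move=> oh Ah Ag gg hg; apply/eqP/negPn/negP => g0.
have := @fmax (option I) (fun o => if o is Some i then h i else g).
rewrite card_option ltnn => H; suff: false by []; apply: H; last by case.
split.
- by case=> // i; apply: (oi_mul oh).
- move=> [i|] [j|] //= ij; [exact: (oi_orth oh)|exact: (hg i).1|exact: (hg j).2].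
by case=> // i; apply: (oi_neq0 oh).
Qed.

(** The Fitting idempotent of [x] could be added to the family. *)
Lemma residual_nil x : A x -> (forall i, f i * x = 0 /\ x * f i = 0) -> nilpot x.
Proof.
move=> Ax fx; have [N [g [y [Ag Ay gg [xy yx] gN]]]] := fit Ax.
have g0 : g = 0.
  apply: (orth_idem_maximal_eq0 oi Af Ag gg) => i; have [fx0 xf0] := fx i.
  by rewrite -{1}xy -yx mulrA fx0 mul0r -mulrA xf0 mulr0.
by exists N; rewrite -gN g0 mul0r.
Qed.

(** Otherwise the Fitting idempotent of an element would split [f i]. *)
Lemma corner_local i : local_corner (corner A (f i)) (f i).
Proof.
split.
- move=> x y [Ax fx xf] [Ay fy yf]; split; first exact: AD.
    by rewrite mulrDr fx fy.
  by rewrite mulrDl xf yf.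
- by move=> x [Ax fx xf]; split; rewrite ?mulrN ?mulNr ?fx ?xf //; apply: AN.
- move=> x y [Ax fx xf] [Ay fy yf]; split; first exact: AM.
    by rewrite mulrA fx.
  by rewrite -mulrA yf.
- by split; rewrite ?(oi_mul oi).
- by move=> x [].
- by move=> x [].
- by apply/eqP/(oi_neq0 oi).
move=> x [Ax fx xf]; have [N [g [y [Ag Ay gg [xy yx] gN]]]] := fit Ax.
have fg : f i * g = g by rewrite -xy mulrA fx.
have gf : g * f i = g by rewrite -yx -mulrA xf.
have [g0|g0] := eqVneq g 0; first by left; exists N; rewrite -gN g0 mul0r.
right; have [gi|gi] := eqVneq (f i - g) 0.
  have gfi : g = f i by apply/eqP; rewrite eq_sym -subr_eq0 gi.
  exists (f i * y * f i); split.
  - split; first by apply: AM => //; apply: AM.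
      by rewrite !mulrA (oi_mul oi).
    by rewrite -!mulrA (oi_mul oi).
  - by rewrite !mulrA xf xy gf.
  by rewrite -!mulrA fx yx fg.
pose h j := if j == i then f i - g else f j.
have oj j : j != i -> f j * g = 0 /\ g * f j = 0.
  move=> ji; split; first by rewrite -fg mulrA (oi_orth oi ji) mul0r.
  by rewrite -gf -mulrA (oi_orth oi) ?mulr0 // eq_sym.
have gg0 : g * (f i - g) = 0 by rewrite mulrBr gf gg subrr.
have gg0' : (f i - g) * g = 0 by rewrite mulrBl fg gg subrr.
case/eqP: g0; apply: (orth_idem_maximal_eq0 (h := h)) => //.
- split=> [j|j l jl|j]; rewrite /h.
  + case: eqP => _; last exact: (oi_mul oi).
    by rewrite mulrBl gg0 subr0 mulrBr (oi_mul oi) fg.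
  + case: eqP => [ji|/eqP ji]; case: eqP => [li|/eqP li].
    * by rewrite ji li eqxx in jl.
    * by rewrite mulrBl (oj l li).2 subr0 (oi_orth oi) // eq_sym.
    * by rewrite mulrBr (oj j ji).1 subr0 (oi_orth oi).
    * exact: (oi_orth oi).
  + by case: (j =P i) => // _; apply: (oi_neq0 oi).
- by move=> j; rewrite /h; case: eqP => // _; apply: AB.
by move=> j; rewrite /h; case: eqP => [_|/eqP /oj //]; split.
Qed.

(** The residual idempotent [peirce None] need not belong to [A], but
    multiplication by it preserves [A]. *)
Definition peirce (o : option I) : B := if o is Some i then f i else 1 - \sum_i f i.

Let f_sum i : f i * (\sum_j f j) = f i /\ (\sum_j f j) * f i = f i.
Proof.
rewrite mulr_sumr mulr_suml; split; rewrite (bigD1 i) //= big1 ?addr0 ?(oi_mul oi) // => j ji.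
  by rewrite (oi_orth oi) // eq_sym.
by rewrite (oi_orth oi).
Qed.

Lemma peirceM o o' : peirce o * peirce o' = if o == o' then peirce o else 0.
Proof.
case: o o' => [i|] [j|] //=.
- exact: oi_mulE oi.
- by rewrite mulrBr mulr1 (f_sum i).1 subrr.
- by rewrite mulrBl mul1r (f_sum j).2 subrr.
rewrite mulrBr mulr1 mulrBl mul1r (_ : (\sum_i f i) * _ = \sum_i f i) ?subrr ?subr0 //.
by rewrite mulr_suml; apply: eq_bigr => i _; rewrite (f_sum i).1.
Qed.

Lemma peirce_sum : \sum_o peirce o = 1.
Proof.
rewrite (bigD1 None) //= (reindex_omap Some id) => [|[i|] //].
by under [X in _ + X]eq_bigl => i do rewrite eqxx; rewrite subrK.
Qed.

Lemma peirce_in o x : A x -> A (peirce o * x) /\ A (x * peirce o).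
Proof.
move=> Ax; case: o => [i|] /=; first by split; apply: AM.
rewrite mulrBr mulrBl mul1r mulr1; split; apply: AB => //; apply: AM => //; exact: A_sum.
Qed.

Lemma ideal_sub_mem R o x : ideal phi A R -> R x -> R (peirce o * x).
Proof.
case=> [[R0 RD RZ] RA RM] Rx; case: o => [i|] /=; first by case: (RM _ _ (Af i) Rx).
rewrite mulrBl mul1r; apply: RD => //; rewrite -mulNr.
have As : A (- \sum_i f i) by apply/AN/A_sum.
by have [] := RM _ _ As Rx.
Qed.

(** [1 - x] is right invertible for [x] in [R], by elimination of one row at a
    time: the row [x1] of [x] is nilpotent because its diagonal entry is, and
    [1 - x1 - x'] is [(1 - x' * y1) * (1 - x1)] with [y1] the inverse of
    [1 - x1].  So [R] contains no idempotent except [0], and the Fitting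
    idempotents of its elements are in [R]. *)
Lemma peirce_nil_ideal R : ideal phi A R ->
  (forall x o, R x -> nilpot (peirce o * x * peirce o)) -> R `<=` Rad phi A.
Proof.
move=> iR nR; have [[R0 RD RZ] RA RM] := iR.
have rinv (s : seq (option I)) : forall x, R x ->
    exists y, (1 - (\sum_(o <- s) peirce o) * x) * y = 1.
  elim: s => [|o s IH] x Rx; first by exists 1; rewrite big_nil mul0r subr0 mulr1.
  set x1 := peirce o * x; have Rx1 : R x1 by apply: ideal_sub_mem.
  have [k nx1] : nilpot x1.
    rewrite /x1 -[peirce o](_ : peirce o * peirce o = _); last by rewrite peirceM eqxx.
    rewrite -mulrA; apply: nilpot_mulC; exact: nR.
  have [inv1 inv2] := nilpot_geometric nx1.
  set y1 := \sum_(i < k) _ in inv1 inv2.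
  have Rxy : R (x * y1).
    rewrite /y1 mulr_sumr; apply: (big_ind R) => // i _.
    elim: (nat_of_ord i) => [|j Rj]; first by rewrite mulr1.
    by rewrite exprSr mulrA; case: (RM _ _ (RA _ Rx1) Rj).
  have [y2 y2E] := IH _ Rxy; exists (y1 * y2).
  rewrite big_cons [_ * x]mulrDl -/x1.
  suff -> : 1 - (x1 + (\sum_(o <- s) peirce o) * x)
      = (1 - (\sum_(o <- s) peirce o) * (x * y1)) * (1 - x1).
    by rewrite -mulrA (mulrA (1 - x1)) inv1 mul1r.
  by rewrite mulrBl mul1r -!mulrA inv2 mulr1 opprD addrA.
have [_ maxJ] := Rad_largest hA; apply: maxJ; split=> // x Rx.
have [N [g [y [Ag Ay gg [xy yx] gN]]]] := fit (RA _ Rx).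
have Rg : R g by rewrite -yx; case: (RM _ _ Ay Rx).
have [z zE] := rinv (index_enum _) g Rg.
rewrite peirce_sum mul1r in zE.
exists N; rewrite -gN -[g](mulr1) -zE mulrA mulrBr mulr1 gg subrr !mul0r //.
Qed.

Let A1 x := A x \/ x = 1.
Let A1l x y : A1 x -> A y -> A (x * y).
Proof. by case=> [Ax|->] Ay; [apply: AM|rewrite mul1r]. Qed.
Let A1r x y : A1 y -> A x -> A (x * y).
Proof. by case=> [Ay|->] Ax; [apply: AM|rewrite mulr1]. Qed.

Lemma residual_corner_nil x : A x -> nilpot (peirce None * x * peirce None).
Proof.
move=> Ax; apply: residual_nil.
  by have [_] := peirce_in None (peirce_in None Ax).1.
move=> i; rewrite -[f i]/(peirce (Some i)); split.
  by rewrite !mulrA peirceM /= !mul0r.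
by rewrite -mulrA peirceM /= mulr0.
Qed.

(** Moving factors cyclically, the hypothesis says that all diagonal Peirce
    components of the ideal generated by [c] are nil. *)
Lemma nil_peirce_Rad o o' c : A c -> c = peirce o * c * peirce o' ->
  (forall x, A1 x -> nilpot (c * (peirce o' * x * peirce o))) -> Rad phi A c.
Proof.
move=> Ac cE nc.
pose R := [set a | A a /\ forall x y k, A1 x -> A1 y ->
  nilpot (peirce k * x * a * y * peirce k)].
have in_A a x y : A a -> A1 x -> A1 y -> A (x * a * y).
  move=> Aa x1 y1; have Axa : A (x * a).
    by case: x1 => [Ax|->]; [apply: AM|rewrite mul1r].
  by case: y1 => [Ay|->]; [apply: AM|rewrite mulr1].
have in_corner a x y i : A a -> A1 x -> A1 y -> corner A (f i) (f i * x * a * y * f i).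
  move=> Aa x1 y1; split.
  - by apply: AM => //; rewrite -[_ * y]mulrA -[_ * x * _]mulrA; apply: AM => //;
      rewrite mulrA; apply: in_A.
  - by rewrite !mulrA (oi_mul oi).
  - by rewrite -!mulrA (oi_mul oi).
have R_ideal : ideal phi A R.
  split; first split.
  - by split=> // x y k _ _; rewrite mulr0 !mul0r; apply: nilpot0.
  - move=> a a' [Aa na] [Aa' na']; split; first exact: AD.
    move=> x y [i|] x1 y1.
      rewrite mulrDr !mulrDl.
      by apply: (lc_nilD (corner_local i)); [exact: in_corner|exact: in_corner|
        exact: (na x y (Some i))|exact: (na' x y (Some i))].
    rewrite -[_ * y]mulrA -[_ * x * _]mulrA; apply: residual_corner_nil.
    by rewrite mulrA; apply: in_A => //; apply: AD.
  - move=> a x [Ax nx]; split; first exact: AZ.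
    move=> y z k y1 z1; rewrite -scalerAr -!scalerAl; apply: nilpot_scale.
    exact: nx.
  - by move=> x [].
  - move=> a x Aa [Ax nx]; split; (split; first exact: AM) => y z k y1 z1.
      rewrite mulrA -[_ * y * a]mulrA; apply: nx => //; left; exact: A1l.
    rewrite mulrA -[_ * a * z]mulrA; apply: nx => //; left; exact: A1r.
apply: (peirce_nil_ideal R_ideal).
  move=> x k [Ax nx]; have := nx 1 1 k (or_intror erefl) (or_intror erefl).
  by rewrite !mulr1.
split=> // x y k x1 y1.
have co : peirce o * c = c by rewrite cE !mulrA peirceM eqxx.
have co' : c * peirce o' = c by rewrite cE -mulrA peirceM eqxx.
have -> : peirce k * x * c * y * peirce k = (peirce k * x) * (c * y * peirce k).
  by rewrite !mulrA.
apply: nilpot_mulC.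
set v := y * peirce k * x.
have -> : c * y * peirce k * (peirce k * x) = c * v.
  by rewrite /v !mulrA -[_ * peirce k * peirce k]mulrA peirceM eqxx.
have -> : c * v = peirce o * (c * (peirce o' * v)).
  by rewrite [c * (peirce o' * _)]mulrA co' mulrA co.
apply: nilpot_mulC; rewrite -mulrA.
have [Av|[xE yE]] : A v \/ (x = 1 /\ y = 1).
  case: x1 => [Ax|xE]; last case: y1 => [Ay|yE]; last by right.
    by left; rewrite /v -mulrA; apply: A1l => //; case: (peirce_in k Ax).
  by left; rewrite /v xE mulr1; case: (peirce_in k Ay).
- by apply: nc; left.
rewrite /v xE yE mul1r mulr1 peirceM; case: eqP => _; last first.
  by rewrite mul0r mulr0; apply: nilpot0.
have := nc 1 (or_intror erefl); rewrite mulr1 //.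
Qed.

Lemma peirce_factor_unit i o c : A c -> c = f i * c * peirce o ->
  (exists2 x, A1 x & ~ nilpot (c * (peirce o * x * f i))) ->
  exists t, [/\ A t, t = peirce o * t * f i & c * t = f i].
Proof.
move=> Ac cE [x x1 nx]; set y0 := c * _ in nx.
have fc : f i * c = c by rewrite cE !mulrA (oi_mul oi).
have Ax : A (peirce o * x * f i) by rewrite -mulrA; apply: (peirce_in o _).1; apply: A1l.
have Ey0 : corner A (f i) y0.
  split; first exact: AM; first by rewrite /y0 [f i * (c * _)]mulrA fc.
  by rewrite /y0 -!mulrA (oi_mul oi).
have [//|[y [[Ay fy yf] y0y _]]] := lc_nilVunit (corner_local i) Ey0.
exists (peirce o * x * f i * y); split; first exact: AM.
  rewrite !mulrA peirceM eqxx; by rewrite -!mulrA yf.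
by rewrite mulrA.
Qed.

Lemma peirce_factor_idem i o c t : c = f i * c * peirce o -> t = peirce o * t * f i ->
  c * t = f i -> (t * c) * (t * c) = t * c /\ t * c <> 0.
Proof.
move=> cE tE ct; have fc : f i * c = c by rewrite cE !mulrA (oi_mul oi).
split; first by rewrite -mulrA (mulrA c) ct fc.
move=> tc0; have := oi_neq0 oi i; rewrite -(oi_mul oi i) -ct -mulrA (mulrA t) tc0.
by rewrite mul0r mulr0 eqxx.
Qed.

Lemma peirce_factor_residual i c t : A c -> A t -> c = f i * c * peirce None ->
  t = peirce None * t * f i -> c * t = f i -> False.
Proof.
move=> Ac At cE tE ct; have [tcI tc0] := peirce_factor_idem cE tE ct.
apply: tc0; apply: nilpot_idem tcI _.
have ft : peirce None * t = t by rewrite tE !mulrA peirceM eqxx.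
have cf : c * peirce None = c by rewrite cE -!mulrA peirceM eqxx.
have -> : t * c = peirce None * (t * c) * peirce None by rewrite mulrA ft -mulrA cf.
by apply: residual_corner_nil; apply: AM.
Qed.

Definition linked i j := exists u v,
  [/\ A u /\ A v, u = f i * u * f j, v = f j * v * f i, u * v = f i & v * u = f j].

Lemma peirce_factor_linked i j c t : A c -> A t -> c = f i * c * f j ->
  t = f j * t * f i -> c * t = f i -> linked i j.
Proof.
move=> Ac At cE tE ct; exists c, t; split=> //.
have [tcI tc0] := @peirce_factor_idem i (Some j) c t cE tE ct.
have ft : f j * t = t by rewrite tE !mulrA (oi_mul oi).
have cf : c * f j = c by rewrite cE -!mulrA (oi_mul oi).
have Etc : corner A (f j) (t * c).
  by split; [exact: AM|rewrite mulrA ft|rewrite -mulrA cf].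
have [ntc|[y [_ tcy _]]] := lc_nilVunit (corner_local j) Etc.
  by case: tc0; apply: nilpot_idem tcI ntc.
rewrite -[LHS](_ : t * c * f j = t * c); last by rewrite -mulrA cf.
by rewrite -{1}tcy mulrA tcI tcy.
Qed.

Lemma linked_refl i : linked i i.
Proof. by exists (f i), (f i); rewrite !(oi_mul oi). Qed.

Lemma linked_sym i j : linked i j -> linked j i.
Proof. by case=> u [v [[Au Av] uE vE uv vu]]; exists v, u. Qed.

Lemma linked_trans i j l : linked i j -> linked j l -> linked i l.
Proof.
case=> u [v [[Au Av] uE vE uv vu]] [u' [v' [[Au' Av'] uE' vE' uv' vu']]].
have fu : f i * u = u by rewrite uE !mulrA (oi_mul oi).
have fv : f j * v = v by rewrite vE !mulrA (oi_mul oi).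
have vf : v * f i = v by rewrite vE -!mulrA (oi_mul oi).
have fu' : f j * u' = u' by rewrite uE' !mulrA (oi_mul oi).
have uf' : u' * f l = u' by rewrite uE' -!mulrA (oi_mul oi).
have fv' : f l * v' = v' by rewrite vE' !mulrA (oi_mul oi).
exists (u * u'), (v' * v); split; first by split; apply: AM.
- by rewrite mulrA fu -mulrA uf'.
- by rewrite mulrA fv' -mulrA vf.
- by rewrite -mulrA (mulrA u') uv' fv uv.
- by rewrite -mulrA (mulrA v) vu fu' vu'.
Qed.

Let e_ i j := `[< linked i j >].
Let rep i := odflt i [pick j | e_ i j].

Let rep_linked i : linked i (rep i).
Proof.
rewrite /rep; case: pickP => [j /asboolP //|no].
by have /asboolP := linked_refl i; rewrite -/(e_ i i) no.
Qed.

Let rep_eq i j : linked i j -> rep i = rep j.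
Proof.
move=> ij; have eij : e_ i =1 e_ j.
  move=> l; apply/asboolP/asboolP => h; last exact: linked_trans ij h.
  exact: linked_trans (linked_sym ij) h.
rewrite /rep (eq_pick eij); case: pickP => // no.
by have /asboolP := linked_refl j; rewrite -/(e_ j j) no.
Qed.

(** Each class of linked idempotents is represented by [rep i], and [u i], [v i]
    identify the corners of [f i] and [f (rep i)].  An element of [A] is in [S]
    when it has residual part zero, entries zero between unlinked idempotents,
    and entries between linked ones that are transported into the subfield
    [D (rep i)]. *)
Lemma peirce_splitting : exists S : set B,
  [/\ subalgebra phi S, S `<=` A & direct_sum A S (Rad phi A)].
Proof.
have [[[[J0 JD JZ] JA JM] Jnil] _] := Rad_largest hA.
have J_sum (T : Type) (r : seq T) (P : pred T) (g : T -> B) :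
    (forall i, P i -> Rad phi A (g i)) -> Rad phi A (\sum_(i <- r | P i) g i).
  by move=> Jg; apply: (big_ind (Rad phi A)).
have /choice[uv uvP] : forall i, exists p : B * B,
    [/\ A p.1 /\ A p.2, p.1 = f i * p.1 * f (rep i), p.2 = f (rep i) * p.2 * f i,
        p.1 * p.2 = f i & p.2 * p.1 = f (rep i)].
  by move=> i; have [u [v h]] := rep_linked i; exists (u, v).
pose u i := (uv i).1; pose v i := (uv i).2.
have uvE i : [/\ A (u i) /\ A (v i), u i = f i * u i * f (rep i),
    v i = f (rep i) * v i * f i, u i * v i = f i & v i * u i = f (rep i)] := uvP i.
have fu i : f i * u i = u i.
  by have [_ uE _ _ _] := uvE i; rewrite uE !mulrA (oi_mul oi).
have uf i : u i * f (rep i) = u i.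
  by have [_ uE _ _ _] := uvE i; rewrite uE -!mulrA (oi_mul oi).
have fv i : f (rep i) * v i = v i.
  by have [_ _ vE _ _] := uvE i; rewrite vE !mulrA (oi_mul oi).
have vf i : v i * f i = v i.
  by have [_ _ vE _ _] := uvE i; rewrite vE -!mulrA (oi_mul oi).
have Au i : A (u i) by have [[]] := uvE i.
have Av i : A (v i) by have [[]] := uvE i.
have uvf i : u i * v i = f i by have [] := uvE i.
have vuf i : v i * u i = f (rep i) by have [] := uvE i.
have [D DP] := choice (fun i => local_splitting clA hA (corner_local i)).
pose es := \sum_i f i.
have es_sum x : es * x * es = \sum_i \sum_j f i * x * f j.
  by rewrite /es mulr_suml mulr_suml; apply: eq_bigr => i _; rewrite mulr_sumr.
have eses : es * es = es.
  by rewrite /es mulr_suml; apply: eq_bigr => i _; rewrite (f_sum i).1.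
have esf i : es * f i = f i := (f_sum i).2.
have fes i : f i * es = f i := (f_sum i).1.
have esE : es = \sum_i f i by [].
clearbody es.
pose S := [set x | [/\ A x, es * x * es = x & forall i j,
  if rep i == rep j then D (rep i) (v i * x * u j) else f i * x * f j = 0]].
have esS x : S x -> es * x = x /\ x * es = x.
  by case=> _ <- _; rewrite -!mulrA eses !mulrA eses.
have S_sub : subspace phi S.
  split.
  - split; [exact: A0|by rewrite mulr0 mul0r|] => i j.
    rewrite !mulr0 !mul0r; case: ifP => // _.
    by have [[]] := DP (rep i).
  - move=> x y [Ax xE xD] [Ay yE yD]; split; first exact: AD.
      by rewrite mulrDr mulrDl xE yE.
    move=> i j; have := xD i j; have := yD i j; case: ifP => _.
      have [[_ DD _] _ _ _ _] := DP (rep i).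
      by rewrite mulrDr mulrDl => Dy Dx; apply: DD.
    by rewrite mulrDr mulrDl => -> ->; rewrite addr0.
  - move=> a x [Ax xE xD]; split; first exact: AZ.
      by rewrite -scalerAr -scalerAl xE.
    move=> i j; have := xD i j; case: ifP => _.
      have [[_ _ DZ] _ _ _ _] := DP (rep i).
      by rewrite -scalerAr -scalerAl; apply: DZ.
    by rewrite -scalerAr -scalerAl => ->; rewrite scaler0.
have S_mul x y : S x -> S y -> S (x * y).
  move=> Sx Sy; have [Ax _ xD] := Sx; have [Ay _ yD] := Sy; split; first exact: AM.
    by rewrite mulrA (esS x Sx).1 -mulrA (esS y Sy).2.
  move=> i j.
  have xyE a c : a * (x * y) * c = \sum_l (a * x * f l) * (f l * y * c).
    rewrite -{1}(esS x Sx).2 esE mulr_sumr mulr_suml mulr_sumr mulr_suml.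
    apply: eq_bigr => l _; rewrite -{1}(oi_mul oi l) !mulrA //.
  rewrite !xyE; case: ifP => [/eqP ij|/eqP ij].
    have [[D0 DD DZ] DM _ _ _] := DP (rep i).
    apply: (big_ind (D (rep i))) => // l _.
    have [il|il] := eqVneq (rep i) (rep l); last first.
      have := xD i l; rewrite (negPf il) => xil.
      by rewrite -(vf i) -!mulrA (mulrA (f i)) (mulrA (f i * x)) xil mul0r mulr0.
    have lj : rep l == rep j by rewrite -il ij.
    have := xD i l; rewrite il eqxx -il => Dx.
    have := yD l j; rewrite lj -il => Dy.
    have -> : v i * x * f l * (f l * y * u j) = (v i * x * u l) * (v l * y * u j).
      by rewrite !mulrA -[_ * f l * f l]mulrA (oi_mul oi) -[_ * u l * v l]mulrA uvf.
    exact: DM.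
  apply: big1 => l _; have [il|il] := eqVneq (rep i) (rep l).
    by have := yD l j; rewrite -il; case: eqP ij => // _ _ ->; rewrite mulr0.
  by have := xD i l; rewrite (negPf il) => ->; rewrite mul0r.
exists S; split=> //; first by move=> x [].
split.
  apply/seteqP; split=> x.
    by case=> y [Ay _ _] [j Jj <-]; apply: AD => //; apply: JA.
  move=> Ax.
  have vxu i j : rep i = rep j -> corner A (f (rep i)) (v i * x * u j).
    move=> ij; split; first by apply: AM => //; apply: AM.
      by rewrite !mulrA fv.
    by rewrite -!mulrA ij uf.
  have /choice[d dP] : forall ij : I * I, exists d, rep ij.1 = rep ij.2 ->
      D (rep ij.1) d /\ nilpot (v ij.1 * x * u ij.2 - d).
    move=> [i j] /=; have [ij|ij] := pselect (rep i = rep j); last by exists 0.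
    have [_ _ _ _ /(_ _ (vxu i j ij)) [d dE]] := DP (rep i).
    by exists d.
  have dc i j : rep i = rep j -> corner A (f (rep i)) (d (i, j)).
    by move=> ij; have [_ _ DE _ _] := DP (rep i); apply: DE; have [] := dP (i, j) ij.
  pose s := \sum_i \sum_(j | rep i == rep j) u i * d (i, j) * v j.
  have As : A s.
    apply: A_sum => i _; apply: A_sum => j /eqP ij.
    by apply: AM => //; apply: AM => //; have [] := dc i j ij.
  have fu0 i i' : i' != i -> f i * u i' = 0.
    by move=> ii; rewrite -fu mulrA (oi_orth oi) ?mul0r // eq_sym.
  have vf0 j j' : j' != j -> v j' * f j = 0.
    by move=> jj; rewrite -vf -mulrA (oi_orth oi) ?mulr0.
  have fsf i j : f i * s * f j = if rep i == rep j then u i * d (i, j) * v j else 0.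
    rewrite /s mulr_sumr mulr_suml (bigD1 i) //= [X in _ + X]big1 ?addr0 => [|i' ii].
      rewrite mulr_sumr mulr_suml; case: ifP => ij.
        rewrite (bigD1 j) //= big1 ?addr0 => [|j' /andP[_ jj]].
          by rewrite !mulrA fu -mulrA vf.
        by rewrite -!mulrA vf0 // !mulr0.
      apply: big1 => j' ij'; have jj : j' != j by apply: contraTneq ij' => ->; rewrite ij.
      by rewrite -!mulrA vf0 // !mulr0.
    rewrite mulr_sumr mulr_suml; apply: big1 => j' _.
    by rewrite !mulrA fu0 // !mul0r.
  have dE i j : rep i = rep j -> v i * s * u j = d (i, j).
    move=> ij; have [_ fd df] := dc i j ij.
    rewrite -(vf i) -(fu j) -[v i * f i * s]mulrA -mulrA [f i * s * _]mulrA fsf ij eqxx.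
    by rewrite !mulrA vuf fd -!mulrA vuf -ij df.
  have esu i : es * u i = u i by rewrite -(fu i) mulrA esf.
  have ves i : v i * es = v i by rewrite -(vf i) -mulrA fes.
  have Ss : S s.
    split=> //.
      rewrite /s mulr_sumr mulr_suml; apply: eq_bigr => i _.
      rewrite mulr_sumr mulr_suml; apply: eq_bigr => j _.
      by rewrite !mulrA esu -mulrA ves.
    move=> i j; case: ifP => ij; last by rewrite fsf ij.
    by rewrite dE; [have [] := dP (i, j) (eqP ij)|exact/eqP].
  exists s => //; exists (x - s); last by rewrite addrC subrK.
  have -> : x - s = \sum_o \sum_o' peirce o * (x - s) * peirce o'.
    rewrite -{1}[x - s]mul1r -{1}[1 * _]mulr1 -peirce_sum mulr_suml mulr_suml.
    by apply: eq_bigr => o _; rewrite mulr_sumr.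
  have Axs : A (x - s) by apply: AB.
  apply: (J_sum) => o _; apply: (J_sum) => o' _.
  have Ac : A (peirce o * (x - s) * peirce o').
    by apply: (peirce_in o' _).2; apply: (peirce_in o _).1.
  have cE : peirce o * (x - s) * peirce o'
      = peirce o * (peirce o * (x - s) * peirce o') * peirce o'.
    by rewrite !mulrA peirceM eqxx -[RHS]mulrA peirceM eqxx.
  apply: (nil_peirce_Rad Ac cE) => y y1.
  case: o Ac cE => [i|] Ac cE; last first.
    have -> : peirce None * (x - s) * peirce o' * (peirce o' * y * peirce None)
        = peirce None * ((x - s) * peirce o' * y) * peirce None.
      by rewrite !mulrA -[_ * peirce o' * peirce o']mulrA peirceM eqxx.
    by apply: residual_corner_nil; apply: A1r => //; apply: (peirce_in o' _).2.
  apply: contrapT => ny.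
  have [|t [At tE ct]] := peirce_factor_unit Ac cE; first by exists y.
  case: o' Ac cE ny tE ct => [j|] Ac cE ny tE ct; last first.
    exact: (peirce_factor_residual Ac At cE tE ct).
  have ij : rep i = rep j := rep_eq (peirce_factor_linked Ac At cE tE ct).
  apply: ny; set m := v i * x * u j - d (i, j).
  have [Dd nm] := dP (i, j) ij; rewrite -/m /= in nm.
  have Em : corner A (f (rep i)) m by apply: (lcB (corner_local (rep i))); [exact: vxu|exact: dc].
  have -> : peirce (Some i) * (x - s) * peirce (Some j) = u i * (m * v j).
    rewrite /= mulrBr mulrBl fsf ij eqxx /m mulrBl mulrBr !mulrA uvf.
    by rewrite -[_ * u j * v j]mulrA uvf.
  rewrite -mulrA; apply: nilpot_mulC; rewrite -!mulrA.
  apply: (lc_nilMr (corner_local (rep i)) Em) nm.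
  split.
  - by rewrite mulrA; apply: (AM (AM (Av j) (Af j))); apply: (A1l y1); exact: (AM (Af i) (Au i)).
  - by rewrite ij mulrA fv.
  by rewrite -!mulrA uf.
apply/seteqP; split=> x.
  case=> Sx Jx; have [Ax xE xD] := Sx; rewrite /= -xE es_sum.
  apply: big1 => i _; apply: big1 => j _; have := xD i j; case: ifP => // ij Dx.
  have [_ _ _ Dnil _] := DP (rep i).
  have vxu0 : v i * x * u j = 0.
    by apply: Dnil => //; apply: Jnil; apply: (JM _ _ (Au j) _).2; apply: (JM _ _ (Av i) _).1.
  have -> : f i * x * f j = u i * (v i * x * u j) * v j.
    by rewrite !mulrA uvf -[_ * u j * v j]mulrA uvf.
  by rewrite vxu0 mulr0 mul0r.
by move=> ->; split=> //; case: S_sub.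
Qed.

End Gluing.

Lemma direct_sum_isomorphic (F K : fieldType) (phi : {rmorphism F -> K})
    (B : falgType K) (A S J : set B) :
  ideal phi A J -> subspace phi S -> S `<=` A -> direct_sum A S J ->
  isomorphic_to_quotient phi S A J.
Proof.
move=> iJ Ssub SA [SJ SJ0]; have [Jsub JA JM] := iJ; have [_ SD _] := Ssub.
exists (coset J); split.
- split.
  + by move=> x Sx; exists x => //; apply: SA.
  + move=> x y; rewrite !inE => Sx Sy xy.
    have : coset J y x by rewrite -xy; apply: coset_refl Jsub.
    case=> j Jj jE; suff j0 : j = 0 by rewrite -jE j0 addr0.
    have : (S `&` J) j; last by rewrite SJ0.
    split=> //; rewrite (_ : j = x - y); last by rewrite -jE addrC addKr.
    by apply: SD => //; apply: subspaceN Ssub _.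
  + move=> _ [a + <-]; rewrite -SJ => -[s Ss [j Jj <-]]; exists s => //.
    by apply/esym/(coset_eq Jsub); exists j.
- by move=> x y Sx Sy; rewrite (coset_addE _ _ Jsub).
- by move=> x y Sx Sy; rewrite (coset_mulE iJ) //; apply: SA.
by move=> a x Sx; rewrite coset_scaleE.
Qed.

Theorem theorem3p33 (F : fieldType) (K : closedFieldType)
    (phi : {rmorphism F -> K}) (B : falgType K)
    (n : nat) (e : n.-tuple B) (he : basis_of fullv e)
    (A : set B) (hA : subalgebra phi A) (hcl : A = zariski_closure e A) :
  exists S : set B,
    [/\ subalgebra phi S, S `<=` A,
        direct_sum A S (Rad phi A)
      & isomorphic_to_quotient phi S A (Rad phi A)].
Proof.
have clA : zclosed e A := closure_zclosed hcl.
have [I [f [[oi Af] fmax]]] : exists (I : finType) (f : I -> B),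
    (orth_idem f /\ forall i, A (f i)) /\
    forall (J : finType) (g : J -> B), orth_idem g /\ (forall j, A (g j)) ->
      (#|J| <= #|I|)%N.
  apply: (@orth_idem_max K B (fun I f => orth_idem f /\ forall i, A (f i)) void (of_void B)).
    by move=> I f [].
  by split; [split; case|case].
have fmax' (J : finType) (g : J -> B) :
    orth_idem g -> (forall j, A (g j)) -> (#|J| <= #|I|)%N.
  by move=> og Ag; apply: fmax (conj og Ag).
have [S [Ssub SA SJ]] := peirce_splitting he clA hA oi Af fmax'.
exists S; split=> //; apply: direct_sum_isomorphic => //; last by case: Ssub.
by have [[]] := Rad_largest hA.
Qed.
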